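(* Consider the linear model $y_i=x_i^T\beta^*+\epsilon_i$, $i=1,\dots,n$, with $\beta^*\in\mathbb{R}^p$ $k$-sparse with support $S$, where instead of $x_i$ one observes $z_i=x_i+w_i$, and the nonconvex program $$\min_{\|\beta\|_1\le R}\Big\{\tfrac12\beta^T\widehat\Gamma\beta-\hat\gamma^T\beta+\lambda\|\beta\|_1\Big\},\qquad(\widehat\Gamma,\hat\gamma)=\Big(\tfrac{Z^TZ}{n}-\Sigma_w,\ \tfrac{Z^Ty}{n}\Big). \qquad (P)$$ There are positive constants $c_0,c_1,c_2,c_3,c_\ell,c_u$ (not depending on $n,p,k$) such that the following holds. Suppose $n\ge k^2$ and $n\ge c_0k\log p$, $(X,w,\epsilon)$ are sub-Gaussian, $\lambda_{\min}(\Sigma_x)>0$, and $(\lambda,R)$ are chosen such that $\|\beta^*\|_1\le\frac R2$ and $c_\ell\sqrt{\frac{\log p}{n}}\le\lambda\le\frac{c_u}{R}$. If in addition $$|||\widehat\Gamma_{SS}^{-1}|||_\infty\le c_\infty\qquad\text{and}\qquad|||\widehat\Gamma_{S^cS}\widehat\Gamma_{SS}^{-1}|||_\infty\le\eta<1,$$ then with probability at least $1-c_1\exp(-c_2\min\{k,\log p\})$, the program $(P)$ has a unique stationary point $\hat\beta$ (corresponding to the global optimum) such that $\mathrm{supp}(\hat\beta)\subseteq\mathrm{supp}(\beta^* )$, and $$\|\hat\beta-\beta^*\|_\infty\le c_3\sqrt{\tfrac{\log p}{n}}+c_\infty\lambda.$$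
   Context: $X,Z\in\mathbb{R}^{n\times p}$ have rows $x_i^T,z_i^T$; $y=(y_i)\in\mathbb{R}^n$ is observed; $\Sigma_x=\mathrm{Cov}(x_i)$; $\Sigma_w=\mathrm{Cov}(w_i)$ is assumed known; $\lambda_{\min}$ is the smallest eigenvalue. ''Sub-Gaussian'' means that the triples $(x_i,w_i,\epsilon_i)$ are i.i.d. over $i$, with $x_i,w_i$ zero-mean sub-Gaussian vectors and $\epsilon_i$ zero-mean sub-Gaussian, and $x_i,w_i,\epsilon_i$ mutually independent (so that $(\widehat\Gamma,\hat\gamma)$ are unbiased for $(\Sigma_x,\Sigma_x\beta^* )$); the constants may depend on the sub-Gaussian parameters and other fixed problem parameters, but not on $n,p,k$. $S=\mathrm{supp}(\beta^* )$, $k$-sparse means $|S|\le k$; $M_{AB}$ denotes the submatrix with rows in $A$, columns in $B$; $|||M|||_\infty$ is the $\ell_\infty$-operator norm (maximum absolute row sum). With $\mathcal{L}_n(\beta)=\frac12\beta^T\widehat\Gamma\beta-\hat\gamma^T\beta$ and $\rho_\lambda(\beta)=\lambda\|\beta\|_1$, a stationary point of $(P)$ is a feasible $\tilde\beta$ such that $\langle\nabla\mathcal{L}_n(\tilde\beta)+\nabla\rho_\lambda(\tilde\beta),\beta-\tilde\beta\rangle\ge0$ for all feasible $\beta$, where $\langle\nabla\rho_\lambda(\tilde\beta),\beta-\tilde\beta\rangle:=\lim_{t\to0^+}\langle\nabla\rho_\lambda(\tilde\beta+t(\beta-\tilde\beta)),\beta-\tilde\beta\rangle$. *)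

(* Defs.v *)
From HB Require Import structures.
From mathcomp Require Export all_boot all_order all_algebra.
From mathcomp Require Export all_classical all_reals all_analysis.
Export Order.TTheory GRing.Theory Num.Theory.
Export numFieldNormedType.Exports.

Set Implicit Arguments.
Unset Strict Implicit.
Unset Printing Implicit Defensive.

Local Open Scope classical_set_scope.
Local Open Scope ring_scope.

Section Vectors.
Context {R : realType}.

Definition dotp p (u v : 'cV[R]_p) : R := (u^T *m v) 0 0.

Definition l1norm p (v : 'cV[R]_p) : R := \sum_j `|v j 0|.
Definition l2norm p (v : 'cV[R]_p) : R := Num.sqrt (\sum_j v j 0 ^+ 2).
Definition linfnorm p (v : 'cV[R]_p) : R := \big[Num.max/0]_j `|v j 0|.

Definition supp p (v : 'cV[R]_p) : {set 'I_p} := [set j | v j 0 != 0]%SET.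

Definition linf_opnorm m n (M : 'M[R]_(m, n)) : R :=
  \big[Num.max/0]_i \sum_j `|M i j|.

Definition submx_of p (M : 'M[R]_p) (A B : {set 'I_p}) : 'M[R]_(#|A|, #|B|) :=
  mxsub (fun i : 'I_#|A| => enum_val i) (fun j : 'I_#|B| => enum_val j) M.

(* Used for symmetric M with 0 < p: the set is then finite and nonempty, so
   the infimum is the smallest eigenvalue. *)
Definition lambda_min p (M : 'M[R]_p) : R := inf [set a | eigenvalue M a].

Definition gradient p (f : 'cV[R]_p -> R) (b : 'cV[R]_p) : 'cV[R]_p :=
  \col_j 'D_(delta_mx j 0) f b.

End Vectors.

Section Program.
Context {R : realType} {p : nat}.
Variables (G : 'M[R]_p) (g : 'cV[R]_p) (lam rad : R).

Definition loss (b : 'cV[R]_p) : R := 2^-1 * dotp b (G *m b) - dotp g b.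

Definition penalty (b : 'cV[R]_p) : R := lam * l1norm b.

Definition feasible (b : 'cV[R]_p) : Prop := l1norm b <= rad.

(* For small t > 0 a coordinate of b + t v vanishes only if v vanishes there,
   so the (unspecified) partial derivatives of the penalty at its kinks are
   multiplied by 0; the function of t is eventually constant at 0+. *)
Definition penalty_slope (b v : 'cV[R]_p) : R :=
  lim ((dotp (gradient penalty (b + t *: v)) v) @[t --> 0^'+]).

Definition stationary_point (b : 'cV[R]_p) : Prop :=
  feasible b /\
  forall b', feasible b' ->
    0 <= dotp (gradient loss b) (b' - b) + penalty_slope b (b' - b).

Definition global_optimum (b : 'cV[R]_p) : Prop :=
  feasible b /\
  forall b', feasible b' -> loss b + penalty b <= loss b' + penalty b'.

End Program.

Section Estimators.
Context {R : realType} {n p : nat}.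

Definition row_matrix (x : 'I_n -> p.-tuple R) : 'M[R]_(n, p) :=
  \matrix_(i, j) tnth (x i) j.

Definition Gamma_hat (Z : 'M[R]_(n, p)) (Sw : 'M[R]_p) : 'M[R]_p :=
  n%:R^-1 *: (Z^T *m Z) - Sw.

Definition gamma_hat (Z : 'M[R]_(n, p)) (y : 'cV[R]_n) : 'cV[R]_p :=
  n%:R^-1 *: (Z^T *m y).

End Estimators.

Section Probability.
Context d {T : measurableType d} {R : realType} (P : probability T R).

Definition coord p (x : T -> p.-tuple R) (j : 'I_p) : T -> R :=
  fun om => tnth (x om) j.

Definition cov_matrix p (x : T -> p.-tuple R) (S : 'M[R]_p) : Prop :=
  forall a b, covariance P (coord x a) (coord x b) = (S a b)%:E.

(* For centred variables: E exp(tX) <= exp(sigma^2 t^2 / 2) for all t. *)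
Definition subgaussian (sigma : R) (X : T -> R) : Prop :=
  forall t : R, (mmt_gen_fun P X t <= (expR (sigma ^+ 2 * t ^+ 2 / 2))%:E)%E.

Definition centred_subgaussian (sigma : R) (X : T -> R) : Prop :=
  ('E_P[X] = 0)%E /\ subgaussian sigma X.

Definition centred_subgaussian_vector p (sigma : R) (x : T -> p.-tuple R) :
    Prop :=
  (forall j, ('E_P[coord x j] = 0)%E) /\
  forall u : 'cV[R]_p, l2norm u = 1 ->
    subgaussian sigma (fun om => \sum_j u j 0 * tnth (x om) j).

Definition independent3 d1 d2 d3 (T1 : measurableType d1)
    (T2 : measurableType d2) (T3 : measurableType d3)
    (X1 : T -> T1) (X2 : T -> T2) (X3 : T -> T3) : Prop :=
  forall (A1 : set T1) (A2 : set T2) (A3 : set T3),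
    measurable A1 -> measurable A2 -> measurable A3 ->
    P (X1 @^-1` A1 `&` X2 @^-1` A2 `&` X3 @^-1` A3) =
    (P (X1 @^-1` A1) * P (X2 @^-1` A2) * P (X3 @^-1` A3))%E.

(* The product rule for subfamilies is the case A i = setT for some of the i. *)
Definition independent_family n d' (T' : measurableType d')
    (X : 'I_n -> T -> T') : Prop :=
  forall A : 'I_n -> set T', (forall i, measurable (A i)) ->
    P (\bigcap_(i in [set: 'I_n]) X i @^-1` A i) =
    (\prod_(i < n) P (X i @^-1` A i))%E.

Definition identically_distributed n d' (T' : measurableType d')
    (X : 'I_n -> T -> T') : Prop :=
  forall i i' (A : set T'), measurable A ->
    P (X i @^-1` A) = P (X i' @^-1` A).

Definition iid n d' (T' : measurableType d') (X : 'I_n -> T -> T') : Prop :=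
  independent_family X /\ identically_distributed X.

Definition subgaussian_model n p (sigx sigw sige : R)
    (x w : 'I_n -> {RV P >-> p.-tuple R}) (eps : 'I_n -> {RV P >-> R}) : Prop :=
  [/\ iid (fun i om => (x i om, w i om, eps i om)),
      forall i, independent3 (x i) (w i) (eps i),
      forall i, centred_subgaussian_vector sigx (x i),
      forall i, centred_subgaussian_vector sigw (w i) &
      forall i, centred_subgaussian sige (eps i)].

End Probability.

(* Main.v *)
(* Primal-dual witness.  By the basic inequality the minimizer of the program
   restricted to S lies in the interior of the l1-ball, so it satisfies the KKT
   conditions on S, and the incoherence hypothesis gives strict dual feasibility
   off S.  Restricted strong convexity,
     v^T G v >= alpha |v|_2^2 - tau |v|_1^2  with tau of order (log p) / n,
   then excludes every other stationary point and makes the witness optimal.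

   Restricted strong convexity is obtained without nets, by Maurey's empirical
   method: up to an error of order |v|_1^2 / m, the quadratic form at v is an
   average of its values at the (2p)^m sums of m signed basis vectors, where a
   union bound with m of order n / (log p) is affordable.

   All deviations needed are those of means of squares of linear forms in
   (x_i, w_i, eps_i), the noise term being reduced to squares by polarization;
   they are controlled by the Chernoff bound. *)

(* The obstacle is that [Gamma_hat] may have negative eigenvalues, so on dense vectors the deficit
   [tau |v|_1^2] can outweigh [alpha |v|_2^2]. The l1-ball saves uniqueness: two feasible points
   differ by at most [2 rad] in l1 norm, so off S the quadratic deficit is at most of order
   [tau rad] times the l1 mass off S. The dual certificate has slack [(1 - eta) / 2] there, and
   [lam] times this slack must pay for it, which requires [tau rad] to be at most a small multiple
   of [lam]. Since [tau] is of order [(log p) / n], hence at most of order [lam^2] by the lower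
   bound on [lam], this is what [lam rad <= cu] provides. On S the deficit is of order
   [tau |S| |v|_2^2], which [n >= c0 k log p] makes small. Randomness enters only through two
   bounds, one for the quadratic form on signed sums and one for the noise; everything after that,
   the incoherence hypotheses included, is argued pointwise on the event where both bounds hold. *)
Require Import Defs.
From mathcomp Require Import measurable_realfun ring lra.

Set Implicit Arguments.
Unset Strict Implicit.
Unset Printing Implicit Defensive.

Local Open Scope classical_set_scope.
Local Open Scope ring_scope.

(** * Inner products and norms *)

Section DotProduct.
Context {R : realType} {p : nat}.
Implicit Types (u v w : 'cV[R]_p) (M : 'M[R]_p) (c : R).

Lemma dotpE u v : dotp u v = \sum_j u j 0 * v j 0.
Proof. by rewrite /dotp mxE; apply: eq_bigr => j _; rewrite mxE. Qed.

Lemma dotpC u v : dotp u v = dotp v u.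
Proof. by rewrite !dotpE; apply: eq_bigr => j _; rewrite mulrC. Qed.

Lemma dotpDl u v w : dotp (u + v) w = dotp u w + dotp v w.
Proof.
by rewrite !dotpE -big_split; apply: eq_bigr => j _; rewrite mxE mulrDl.
Qed.

Lemma dotpDr u v w : dotp w (u + v) = dotp w u + dotp w v.
Proof. by rewrite dotpC dotpDl !(dotpC w). Qed.

Lemma dotpZl c u v : dotp (c *: u) v = c * dotp u v.
Proof.
by rewrite !dotpE mulr_sumr; apply: eq_bigr => j _; rewrite mxE mulrA.
Qed.

Lemma dotpZr c u v : dotp u (c *: v) = c * dotp u v.
Proof. by rewrite dotpC dotpZl dotpC. Qed.

Lemma dotpNl u v : dotp (- u) v = - dotp u v.
Proof. by rewrite -scaleN1r dotpZl mulN1r. Qed.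

Lemma dotpNr u v : dotp u (- v) = - dotp u v.
Proof. by rewrite dotpC dotpNl dotpC. Qed.

Lemma dotp0l v : dotp 0 v = 0.
Proof. by rewrite -(scale0r (0 : 'cV[R]_p)) dotpZl mul0r. Qed.

Lemma dotp0r v : dotp v 0 = 0.
Proof. by rewrite dotpC dotp0l. Qed.

Lemma dotp_sumr (I : Type) (r : seq I) (P : pred I) (F : I -> 'cV[R]_p) u :
  dotp u (\sum_(i <- r | P i) F i) = \sum_(i <- r | P i) dotp u (F i).
Proof.
by elim/big_rec2 : _ => [|i a b _ <-]; rewrite ?dotp0r ?dotpDr.
Qed.

Lemma dotp_delta u j : dotp u (delta_mx j 0) = u j 0.
Proof.
rewrite dotpE (bigD1 j)//= mxE !eqxx mulr1 big1 ?addr0// => i ij.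
by rewrite mxE (negPf ij) mulr0.
Qed.

Lemma dotp_mulmx q (u : 'cV[R]_q) (M : 'M[R]_(q, p)) v :
  dotp u (M *m v) = dotp (M^T *m u) v.
Proof. by rewrite /dotp trmx_mul trmxK mulmxA. Qed.

Lemma dotp_sym M u v : M^T = M -> dotp u (M *m v) = dotp v (M *m u).
Proof. by move=> MT; rewrite dotp_mulmx MT dotpC. Qed.

Lemma dotp_quadE M u v :
  dotp u (M *m v) = \sum_i \sum_j M i j * u i 0 * v j 0.
Proof.
rewrite dotpE; apply: eq_bigr => i _; rewrite mxE mulr_sumr.
by apply: eq_bigr => j _; ring.
Qed.

Lemma dotp_quadD M u v : M^T = M ->
  dotp (u + v) (M *m (u + v)) =
  dotp u (M *m u) + 2 * dotp u (M *m v) + dotp v (M *m v).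
Proof.
by move=> MT; rewrite mulmxDr !dotpDl !dotpDr (dotp_sym v u MT); ring.
Qed.

Lemma dotpvv_ge0 v : 0 <= dotp v v.
Proof. by rewrite dotpE sumr_ge0// => j _; rewrite -expr2 sqr_ge0. Qed.

Lemma dotpvv_eq0 v : dotp v v = 0 -> v = 0.
Proof.
rewrite dotpE => /eqP; rewrite psumr_eq0 => [|j _]; last first.
  by rewrite -expr2 sqr_ge0.
move=> /allP v0; apply/matrixP => j i; rewrite ord1 mxE; apply/eqP.
by have := v0 j (mem_index_enum _); rewrite /= mulf_eq0 orbb.
Qed.

Lemma l2norm_dotp v : l2norm v ^+ 2 = dotp v v.
Proof.
rewrite dotpE sqr_sqrtr; last by rewrite sumr_ge0// => j _; exact: sqr_ge0.
by apply: eq_bigr => j _; rewrite expr2.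
Qed.

Lemma l2norm_ge0 v : 0 <= l2norm v.
Proof. exact: sqrtr_ge0. Qed.

Lemma l2normZ c v : l2norm (c *: v) = `|c| * l2norm v.
Proof.
apply/eqP; rewrite -(eqrXn2 (n := 2))// ?mulr_ge0 ?l2norm_ge0//.
by rewrite exprMn real_normK ?num_real// !l2norm_dotp dotpZl dotpZr; apply/eqP; ring.
Qed.

Lemma l2norm_eq0 v : l2norm v = 0 -> v = 0.
Proof. by move=> v0; apply: dotpvv_eq0; rewrite -l2norm_dotp v0 expr0n. Qed.

Lemma l2norm_delta j : l2norm (delta_mx j 0 : 'cV[R]_p) = 1.
Proof.
apply/eqP; rewrite -(eqrXn2 (n := 2))// ?l2norm_ge0// l2norm_dotp dotp_delta.
by rewrite mxE !eqxx expr1n.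
Qed.

Lemma cauchy_schwarz u v : `|dotp u v| <= l2norm u * l2norm v.
Proof.
have [->|v0] := eqVneq v 0; first by rewrite dotp0r normr0 mulr_ge0 ?l2norm_ge0.
have vv : 0 < dotp v v.
  by rewrite lt_neqAle dotpvv_ge0 andbT eq_sym; apply: contra_neq v0; exact: dotpvv_eq0.
rewrite -(ler_pXn2r (n := 2))// ?nnegrE ?mulr_ge0 ?l2norm_ge0//.
rewrite real_normK ?num_real// exprMn !l2norm_dotp.
have := dotpvv_ge0 (dotp v v *: u - dotp u v *: v).
have -> : dotp (dotp v v *: u - dotp u v *: v) (dotp v v *: u - dotp u v *: v) =
    dotp v v * (dotp u u * dotp v v - dotp u v ^+ 2).
  by rewrite !(dotpDl, dotpDr, dotpNl, dotpNr, dotpZl, dotpZr) (dotpC v u); ring.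
by rewrite pmulr_rge0// subr_ge0.
Qed.

Lemma l2normD u v : l2norm (u + v) <= l2norm u + l2norm v.
Proof.
rewrite -(ler_pXn2r (n := 2))// ?nnegrE ?addr_ge0 ?l2norm_ge0//.
rewrite l2norm_dotp sqrrD !l2norm_dotp dotpDl !dotpDr (dotpC v u).
have := le_trans (ler_norm _) (cauchy_schwarz u v); lra.
Qed.

End DotProduct.

Section L1Norm.
Context {R : realType} {p : nat}.
Implicit Types (u v : 'cV[R]_p) (c : R).

Lemma l1norm_ge0 v : 0 <= l1norm v.
Proof. exact: sumr_ge0. Qed.

Lemma l1normD u v : l1norm (u + v) <= l1norm u + l1norm v.
Proof. by rewrite -big_split ler_sum// => j _; rewrite mxE ler_normD. Qed.

Lemma l1normN v : l1norm (- v) = l1norm v.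
Proof. by apply: eq_bigr => j _; rewrite mxE normrN. Qed.

Lemma l1normZ c v : l1norm (c *: v) = `|c| * l1norm v.
Proof. by rewrite /l1norm mulr_sumr; apply: eq_bigr => j _; rewrite mxE normrM. Qed.

Lemma holder u v c : (forall j, `|u j 0| <= c) -> `|dotp u v| <= c * l1norm v.
Proof.
move=> uc; rewrite dotpE mulr_sumr (le_trans (ler_norm_sum _ _ _))//.
by apply: ler_sum => j _; rewrite normrM ler_wpM2r.
Qed.

(** Cauchy-Schwarz between the indicator of [A] and the vector of absolute values. *)
Lemma sum_norm_sqr_le (A : {set 'I_p}) v :
  (\sum_(j in A) `|v j 0|) ^+ 2 <= #|A|%:R * dotp v v.
Proof.
pose u : 'cV[R]_p := \col_j (j \in A)%:R.
pose w : 'cV[R]_p := \col_j `|v j 0|.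
have -> : \sum_(j in A) `|v j 0| = dotp u w.
  rewrite dotpE big_mkcond; apply: eq_bigr => j _; rewrite !mxE.
  by case: ifP; rewrite ?mul1r ?mul0r.
have -> : dotp v v = dotp w w.
  rewrite !dotpE; apply: eq_bigr => j _.
  by rewrite !mxE -normrM ger0_norm// -expr2 sqr_ge0.
have -> : #|A|%:R = dotp u u.
  rewrite dotpE -sum1_card natr_sum big_mkcond; apply: eq_bigr => j _.
  by rewrite !mxE; case: ifP; rewrite ?mul1r ?mul0r.
rewrite -!l2norm_dotp -exprMn -(real_normK (num_real (dotp u w))).
by rewrite ler_pXn2r ?nnegrE ?mulr_ge0 ?l2norm_ge0// cauchy_schwarz.
Qed.

End L1Norm.

(** * Directional derivatives *)

Section Derivatives.
Context {R : realType} {p : nat}.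
Implicit Types (b v : 'cV[R]_p) (G : 'M[R]_p).

(** The loss is quadratic, so its second-order expansion is exact; the gradient and the later
    comparisons of objective values are read off from it. *)
Lemma lossD G (g : 'cV[R]_p) b v : G^T = G ->
  loss G g (b + v) =
  loss G g b + dotp (G *m b - g) v + 2^-1 * dotp v (G *m v).
Proof.
move=> GT; rewrite /loss dotp_quadD// dotpDr dotpDl dotpNl.
rewrite (dotpC (G *m b)) (dotp_sym v b GT); lra.
Qed.

Lemma gradient_loss G (g : 'cV[R]_p) b : G^T = G ->
  gradient (loss G g) b = G *m b - g.
Proof.
move=> GT; apply/matrixP => j i; rewrite ord1 mxE {i}.
rewrite -[RHS]dotp_delta; set e := delta_mx j 0; set c := dotp _ e.
pose d := 2^-1 * dotp e (G *m e).
apply/cvg_lim => //.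
(* By [lossD] the difference quotient along [e] is exactly [c + h * d] for [h != 0]. *)
have : (fun h : R => c + h * d) @ (0:R)^' --> c + 0 * d.
  apply: cvg_within_filter; apply: cvgD; first exact: cvg_cst.
  by apply: cvgMr_tmp; exact: cvg_id.
rewrite mul0r addr0; apply: cvg_trans; apply: near_eq_cvg.
near=> h.
have h0 : h != 0 by near: h; exact: nbhs_dnbhs_neq.
rewrite /= /shift/= [h *: e + b]addrC lossD//.
rewrite -scalemxAr !dotpZr dotpZl -/c /d.
move: (dotp e _) (loss _ _ _) => D L.
by transitivity (h^-1 * (L + h * c + 2^-1 * (h * (h * D)) - L)); first field.
Unshelve. all: by end_near.
Qed.

Lemma sgr_near (a v : R) : a != 0 ->
  \forall t \near (0 : R), Num.sg (a + t * v) = Num.sg a.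
Proof.
move=> a0.
have cv : (fun t : R => a + t * v) @ (0 : R) --> a.
  rewrite -[X in _ --> X]addr0 -[X in a + X](mul0r v).
  by apply: cvgD; [exact: cvg_cst | apply: cvgMr_tmp; exact: cvg_id].
have [ap|an|/eqP] := ltrgt0P a; last by rewrite (negPf a0).
- by near=> t; rewrite (gtr0_sg (x := _ + _)) ?(gtr0_sg ap)//; near: t; exact: (cvgr_gt a).
- by near=> t; rewrite (ltr0_sg (x := _ + _)) ?(ltr0_sg an)//; near: t; exact: (cvgr_lt a).
Unshelve. all: by end_near.
Qed.

Lemma gradient_penalty (lam : R) b j : b j 0 != 0 ->
  gradient (penalty lam) b j 0 = lam * Num.sg (b j 0).
Proof.
move=> bj0; rewrite mxE.
apply: lim_near_cst => //; near=> h.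
have h0 : h != 0 by near: h; exact: nbhs_dnbhs_neq.
have sgE : Num.sg (b j 0 + h * 1) = Num.sg (b j 0).
  by near: h; apply: cvg_within; exact: sgr_near.
rewrite /= /shift/= /penalty -mulrBr /l1norm -sumrB (bigD1 j)//= big1 => [|i ij].
  rewrite !mxE !eqxx mulr1 addr0.
  rewrite (normrEsg (h + _)) [X in Num.sg X]addrC.
  rewrite mulr1 in sgE; rewrite sgE normrEsg.
  by transitivity (h^-1 * (lam * (Num.sg (b j 0) * (h + b j 0) - Num.sg (b j 0) * b j 0)));
    last field.
by rewrite !mxE (negPf ij) mulr0 add0r subrr.
Unshelve. all: by end_near.
Qed.

(** The right derivative at 0 of [t |-> l1norm (b + t v)]; a coordinate at a kink contributes
    [|v_j|]. *)
Definition l1slope b v : R :=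
  \sum_j (if b j 0 == 0 then `|v j 0| else Num.sg (b j 0) * v j 0).

(** For small [t > 0] the sign of [b_j + t v_j] is frozen: it is that of [b_j], or that of [v_j]
    when [b_j = 0]. *)
Lemma penalty_slopeE (lam : R) b v : penalty_slope lam b v = lam * l1slope b v.
Proof.
apply: lim_near_cst => //.
have : \forall t \near (0 : R)^'+, forall j, b j 0 != 0 ->
    Num.sg (b j 0 + t * v j 0) = Num.sg (b j 0).
  apply: filter_forall => j; have [->|bj] := eqVneq (b j 0) 0.
    exact: nearW.
  by near=> t; move=> _; near: t; apply: cvg_within; exact: sgr_near.
move=> H; near=> t.
have t0 : 0 < t by near: t; exact: nbhs_right_gt.
have Hs : forall j, b j 0 != 0 ->
    Num.sg (b j 0 + t * v j 0) = Num.sg (b j 0) by near: t.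
rewrite dotpE /l1slope mulr_sumr; apply: eq_bigr => j _.
have [->|vj] := eqVneq (v j 0) 0; first by rewrite normr0 !mulr0 if_same mulr0.
have E : (b + t *: v) j 0 = b j 0 + t * v j 0 by rewrite !mxE.
rewrite gradient_penalty E; last first.
  have [->|bj] := eqVneq (b j 0) 0; last by rewrite -sgr_eq0 Hs// sgr_eq0.
  by rewrite add0r mulf_neq0// gt_eqF.
case: eqP => [->|/eqP bj]; last by rewrite Hs// mulrA.
by rewrite add0r sgrM gtr0_sg// mul1r -mulrA -normrEsg.
Unshelve. all: by end_near.
Qed.

(** Convexity, one coordinate at a time; it turns stationarity of a point into a comparison of l1
    norms. *)
Lemma l1slope_le b v : l1slope b v <= l1norm (b + v) - l1norm b.
Proof.
rewrite -sumrB; apply: ler_sum => j _; rewrite mxE.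
case: eqP => [->|_]; first by rewrite add0r normr0 subr0.
rewrite lerBrDr [X in _ + X]normrEsg -mulrDr addrC.
apply: le_trans (ler_norm _) _; rewrite normrM -[leRHS]mul1r ler_wpM2r//.
by rewrite normr_sg; case: (_ != _).
Qed.

(** The hypotheses say that [z] is a subgradient of the l1 norm at [b], and a directional derivative
    dominates every subgradient. *)
Lemma le_l1slope b v (z : 'cV[R]_p) :
  (forall j, `|z j 0| <= 1) -> (forall j, z j 0 * b j 0 = `|b j 0|) ->
  dotp z v <= l1slope b v.
Proof.
move=> z1 zb; rewrite dotpE; apply: ler_sum => j _.
case: eqP => [_|/eqP bj].
  by apply: le_trans (ler_norm _) _; rewrite normrM -[leRHS]mul1r ler_wpM2r.
by rewrite -(mulfK bj (z j 0)) zb normrEsg mulfK.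
Qed.

End Derivatives.

(** * Minimizers and the smallest eigenvalue *)

Section Minimizers.
Context {R : realType} {p : nat}.

(** Compactness, shared by the restricted program and the Rayleigh quotient. Row vectors are the
    setting of [EVT_min_rV], hence the transposes in the continuity lemmas. *)
Lemma min_on_closed_bounded (A : set 'rV[R]_p) (M : R) (f : 'rV[R]_p -> R) :
  A !=set0 -> closed A -> (forall v, A v -> forall j, `|v 0 j| <= M) ->
  continuous f -> exists2 c, A c & forall v, A v -> f c <= f v.
Proof.
move=> A0 clA bA cf.
have bdA : bounded_set A.
  exists (Num.max 0 M); split; first exact: num_real.
  move=> r rM v Av; rewrite /= (_ : `|v| = mx_norm v)// mx_normrE.
  have r0 : 0 <= r by rewrite ltW// (le_lt_trans _ rM)// le_max lexx.
  apply: bigmax_le => // -[i j] _ /=; rewrite ord1.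
  by rewrite (le_trans (bA v Av j))// ltW// (le_lt_trans _ rM)// le_max lexx orbT.
have [c cA cmin] := EVT_min_rV A0 (bounded_closed_compact bdA clA)
  (continuous_subspaceT cf).
exists c; first by rewrite inE in cA.
by move=> v Av; apply: cmin; rewrite inE.
Qed.

Lemma continuous_sum (I : finType) (f : I -> 'rV[R]_p -> R) :
  (forall i, continuous (f i)) -> continuous (fun v => \sum_i f i v).
Proof.
by move=> cf; apply: continuous_big => [|i _]; [exact: add_continuous | exact: cf].
Qed.

Lemma continuous_coord j : continuous (fun v : 'rV[R]_p => v^T j 0).
Proof.
rewrite (_ : (fun v => _) = fun v : 'rV[R]_p => v 0 j); first exact: coord_continuous.
by apply/funext => v; rewrite mxE.
Qed.

Lemma continuous_mull (c : R) (f : 'rV[R]_p -> R) :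
  continuous f -> continuous (fun v => c * f v).
Proof. by move=> cf v; exact: (cvgMl_tmp (cf v)). Qed.

Lemma continuous_dotp (u : 'cV[R]_p) :
  continuous (fun v : 'rV[R]_p => dotp u v^T).
Proof.
under eq_fun do rewrite dotpE.
by apply: continuous_sum => j; apply: continuous_mull; exact: continuous_coord.
Qed.

Lemma continuous_quad (G : 'M[R]_p) :
  continuous (fun v : 'rV[R]_p => dotp v^T (G *m v^T)).
Proof.
under eq_fun do rewrite dotp_quadE.
apply: continuous_sum => i; apply: continuous_sum => j.
under eq_fun do rewrite -mulrA; apply: continuous_mull.
by move=> v; exact: (cvgM (@continuous_coord i v) (@continuous_coord j v)).
Qed.

Lemma continuous_l1norm : continuous (fun v : 'rV[R]_p => l1norm v^T).
Proof.
by apply: continuous_sum => j v; exact: (cvg_norm (@continuous_coord j v)).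
Qed.

Lemma norm_le_l1norm (v : 'cV[R]_p) j : `|v j 0| <= l1norm v.
Proof. by rewrite /l1norm (bigD1 j)//= lerDl sumr_ge0. Qed.

(** The support constraint is removed by the coordinate projection [D] onto S: the objective
    composed with [D] is minimized over the whole l1-ball and the minimizer is projected. [D] does
    not increase the l1 norm and fixes the vectors supported on S. *)
Lemma min_restricted (G : 'M[R]_p) (g : 'cV[R]_p) (lam rad : R) (S : {set 'I_p}) :
  0 <= rad ->
  exists b : 'cV[R]_p, [/\ l1norm b <= rad, supp b \subset S &
    forall b', l1norm b' <= rad -> supp b' \subset S ->
      loss G g b + penalty lam b <= loss G g b' + penalty lam b'].
Proof.
move=> rad0.
pose D : 'M[R]_p := diag_mx (\row_j (j \in S)%:R).
have DE (v : 'cV[R]_p) j : (D *m v) j 0 = (j \in S)%:R * v j 0.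
  by rewrite mul_diag_mx !mxE.
have DT : D^T = D by rewrite tr_diag_mx.
have Dle (v : 'cV[R]_p) : l1norm (D *m v) <= l1norm v.
  apply: ler_sum => j _; rewrite DE; case: (_ \in _); rewrite ?mul1r//.
  by rewrite mul0r normr0.
have Dsupp (v : 'cV[R]_p) : supp (D *m v) \subset S.
  by apply/fintype.subsetP => j; rewrite inE DE; case: (_ \in _); rewrite // mul0r eqxx.
have Did (v : 'cV[R]_p) : supp v \subset S -> D *m v = v.
  move=> /fintype.subsetP vS; apply/matrixP => j i; rewrite ord1 DE.
  have := vS j; rewrite inE; case: (_ \in _) => /=; first by rewrite mul1r.
  by case: eqP => [->|_ /(_ isT)]//; rewrite mulr0.
pose f (v : 'rV[R]_p) := loss (D *m G *m D) (D *m g) v^T + lam * l1norm (D *m v^T).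
have fE (v : 'cV[R]_p) : f v^T = loss G g (D *m v) + penalty lam (D *m v).
  rewrite /f trmxK /loss /penalty -!mulmxA dotp_mulmx DT.
  by rewrite (dotpC (D *m g)) [dotp v _]dotp_mulmx DT (dotpC _ g).
have cf : continuous f.
  have cl : continuous (fun v : 'rV[R]_p => lam * l1norm (D *m v^T)).
    apply: continuous_mull; apply: continuous_sum => j.
    rewrite (_ : (fun v => _) = fun v : 'rV[R]_p => `|(j \in S)%:R * v^T j 0|); last first.
      by apply/funext => v; rewrite DE.
    by move=> v; exact: (cvg_norm (@continuous_mull (j \in S)%:R _ (@continuous_coord j) v)).
  have cq := @continuous_mull 2^-1 _ (@continuous_quad (D *m G *m D)).
  by move=> v; exact: (cvgD (cvgB (cq v) (@continuous_dotp (D *m g) v)) (cl v)).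
have [|||c cr cmin] := @min_on_closed_bounded [set v | l1norm v^T <= rad] rad f _ _ _ cf.
- exists 0; rewrite /= trmx0 /l1norm big1// => j _; by rewrite mxE normr0.
- have /continuous_closedP := continuous_l1norm.
  by move=> /(_ _ (@closed_le R rad)).
- by move=> v /= vr j; rewrite (le_trans _ vr)// (le_trans _ (norm_le_l1norm _ j))// mxE.
exists (D *m c^T); split => //; first by rewrite (le_trans (Dle _)).
move=> b' b'r b'S; have := cmin b'^T; rewrite /= trmxK => /(_ b'r).
by rewrite -[in f c](trmxK c) !fE (Did b').
Qed.

(** The minimum [mu] of the form on the unit sphere is itself an eigenvalue, so the infimum of the
    eigenvalues is at most [mu]. That [mu] bounds them from below only serves to make [ge_inf]
    applicable. *)
Lemma lambda_min_quad (M : 'M[R]_p) (v : 'cV[R]_p) : M^T = M ->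
  lambda_min M * dotp v v <= dotp v (M *m v).
Proof.
move=> MT; have [->|v0] := eqVneq v 0; first by rewrite !dotp0l mulr0.
pose A := [set u : 'rV[R]_p | dotp u^T (1%:M *m u^T) = 1].
have scaleA (u : 'cV[R]_p) : u != 0 -> A ((l2norm u)^-1 *: u)^T.
  move=> u0; rewrite /A /= trmxK mul1mx dotpZl dotpZr -l2norm_dotp.
  have : l2norm u != 0 by apply: contra_neq u0; exact: l2norm_eq0.
  by move=> ?; field.
have [||| |c Ac cmin] := @min_on_closed_bounded A 1 (fun u => dotp u^T (M *m u^T)).
- by exists ((l2norm v)^-1 *: v)^T; exact: scaleA.
- have /continuous_closedP := @continuous_quad 1%:M.
  by move=> /(_ _ (@closed_eq R 1)).
- move=> u; rewrite /A /= mul1mx => u1 j.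
  rewrite -(ler_pXn2r (n := 2))// ?nnegrE// expr1n -u1 dotpE (bigD1 j)//= !mxE.
  rewrite real_normK ?num_real// expr2 lerDl sumr_ge0// => i _.
  by rewrite -expr2 sqr_ge0.
- exact: continuous_quad.
set mu := dotp c^T (M *m c^T) in cmin.
rewrite /A /= mul1mx in Ac.
have quad (u : 'cV[R]_p) : mu * dotp u u <= dotp u (M *m u).
  have [->|u0] := eqVneq u 0; first by rewrite !dotp0l mulr0.
  have := cmin _ (scaleA u u0); rewrite trmxK -scalemxAr dotpZl dotpZr.
  have l0 : 0 < l2norm u.
    rewrite lt_neqAle l2norm_ge0 andbT eq_sym; apply: contra_neq u0.
    exact: l2norm_eq0.
  rewrite mulrA -invfM -expr2 l2norm_dotp mulrC ler_pdivlMr//.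
  by rewrite -l2norm_dotp exprn_gt0.
apply: le_trans (quad v); rewrite ler_wpM2r ?dotpvv_ge0//.
have lbmu : lbound [set a | eigenvalue M a] mu.
  move=> a /= /eigenvalueP[u uM u0].
  have := quad u^T; have -> : M *m u^T = a *: u^T by rewrite -{1}MT -trmx_mul uM linearZ.
  rewrite dotpZr.
  rewrite ler_pM2r// lt_neqAle dotpvv_ge0 andbT eq_sym.
  by apply: contra_neq u0 => /dotpvv_eq0 /(congr1 trmx); rewrite trmxK trmx0.
apply: ge_inf; first by exists mu.
apply/eigenvalueP; exists c; last first.
  apply: contra_eq_neq Ac => ->; rewrite trmx0 dotp0l.
  by rewrite eq_sym oner_eq0.
(* c minimizes the nonnegative quadratic form of M - mu, hence lies in its kernel *)
set N := M - mu%:M.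
have NT : N^T = N by rewrite /N linearB /= MT tr_scalar_mx.
have N0 u : 0 <= dotp u (N *m u).
  by rewrite /N mulmxBl mul_scalar_mx dotpDr dotpNr dotpZr subr_ge0.
have Nc : dotp c^T (N *m c^T) = 0.
  by rewrite /N mulmxBl mul_scalar_mx dotpDr dotpNr dotpZr Ac mulr1 subrr.
suff Nc0 : N *m c^T = 0.
  have /(congr1 trmx) := Nc0; rewrite trmx_mul trmxK NT trmx0 /N mulmxBr mul_mx_scalar.
  by move/eqP; rewrite subr_eq0 => /eqP.
set w := N *m c^T; apply: dotpvv_eq0; apply/eqP; rewrite eq_le dotpvv_ge0 andbT.
rewrite leNgt; apply/negP => ww.
set q := dotp w (N *m w).
(* At [c - t w] the form of [N] equals [- t (2 <w,w> - t q)], which is negative for this [t]; the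
   [+ 1] guards against [q = 0]. *)
pose t := dotp w w / (q + 1).
have q0 : 0 <= q by exact: N0.
have t0 : 0 < t by rewrite divr_gt0// ltr_wpDl.
have := N0 (c^T + (- t) *: w).
rewrite dotp_quadD// Nc add0r -scalemxAr !(dotpZl, dotpZr) -/q.
rewrite (dotp_sym _ _ NT) -/w.
have -> : 2 * (- t * dotp w w) + - t * (- t * q) = - t * (2 * dotp w w - t * q) by ring.
rewrite mulNr oppr_ge0 pmulr_rle0//.
have -> : dotp w w = t * (q + 1) by rewrite /t divfK// gt_eqF// ltr_wpDl.
move=> h; have : t * (q + 2) <= 0 by lra.
by rewrite pmulr_rle0//; lra.
Qed.

End Minimizers.

(** * The primal-dual witness *)

Section PrimalDualWitness.
Context {R : realType}.

Lemma linf_opnorm_ge0 m n (M : 'M[R]_(m, n)) : 0 <= linf_opnorm M.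
Proof. exact: bigmax_ge_id. Qed.

Lemma linf_opnorm_mul m n (M : 'M[R]_(m, n)) (r : 'cV[R]_n) c i :
  (forall j, `|r j 0| <= c) -> `|(M *m r) i 0| <= linf_opnorm M * c.
Proof.
move=> rc; have [n0|n0] := posnP n.
  subst n; rewrite mxE big_ord0 normr0.
  have -> : linf_opnorm M = 0.
    by rewrite /linf_opnorm big1_idem //= ?maxxx// => k _; rewrite big_ord0.
  by rewrite mul0r.
have c0 : 0 <= c by apply: le_trans (rc (Ordinal n0)).
rewrite mxE (le_trans (ler_norm_sum _ _ _))//.
apply: (@le_trans _ _ ((\sum_j `|M i j|) * c)).
  by rewrite mulr_suml; apply: ler_sum => j _; rewrite normrM ler_wpM2l.
by rewrite ler_wpM2r// /linf_opnorm; apply: le_bigmax.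
Qed.

Lemma le0_of_small (a D r : R) : 0 < r ->
  (forall s, 0 < s <= r -> a <= s * D) -> a <= 0.
Proof.
move=> r0 H; rewrite leNgt; apply/negP => a0.
have D0 : 0 < D.
  have := H r; rewrite r0 lexx => /(_ isT) /(lt_le_trans a0).
  by rewrite pmulr_rgt0.
pose s := Num.min r (a / (2 * D)).
have s0 : 0 < s by rewrite lt_min r0/= divr_gt0// mulr_gt0.
have := H s; rewrite s0 ge_min lexx => /(_ isT) h.
have : s * D <= a / (2 * D) * D by rewrite ler_pM2r// ge_min lexx orbT.
have -> : a / (2 * D) * D = a / 2 by field; rewrite gt_eqF.
lra.
Qed.

(** Optimality of [t = 0] in a one-dimensional lasso problem. Moving against the sign of [c] bounds
    [|c|]; shrinking [x] towards 0 gives the equation, whose product form also covers [x = 0]. *)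
Lemma scalar_kkt (c d lam x r : R) : 0 < r ->
  (forall t, `|t| <= r ->
    0 <= t * c + 2^-1 * (t ^+ 2 * d) + lam * (`|x + t| - `|x|)) -> 0 < lam ->
  `|c| <= lam /\ c * x = - (lam * `|x|).
Proof.
move=> r0 H lam0.
have clam : `|c| <= lam.
  rewrite -subr_le0; apply: (@le0_of_small _ (`|d|) r) => // s /andP[s0 sr].
  have ts : `|- s * Num.sg c| <= s.
    rewrite normrM normrN (gtr0_norm s0) normr_sg -[leRHS]mulr1 ler_pM2l//.
    by case: (_ != _).
  have := H (- s * Num.sg c) (le_trans ts sr); set t := _ * Num.sg c.
  have -> : t * c = - (s * `|c|) by rewrite /t normrEsg; ring.
  have h1 : t ^+ 2 * d <= s ^+ 2 * `|d|.
    apply: le_trans (ler_norm _) _; rewrite normrM ler_wpM2r// ger0_norm ?sqr_ge0//.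
    by rewrite -[t ^+ 2]real_normK ?num_real// ler_pXn2r// nnegrE ltW.
  have h2 : lam * (`|x + t| - `|x|) <= lam * s.
    by rewrite ler_pM2l// lerBlDl (le_trans (ler_normD _ _))// lerD2l.
  have d0 : 0 <= s ^+ 2 * `|d| by rewrite mulr_ge0 ?sqr_ge0.
  move=> h3; have : s * (`|c| - lam) <= s * (s * `|d|) by rewrite mulrA -expr2; nra.
  by rewrite ler_pM2l.
split => //; apply/eqP; rewrite -addr_eq0 eq_le; apply/andP; split; last first.
  have : `|c * x| <= lam * `|x| by rewrite normrM ler_wpM2r.
  by have := ler_norm (- (c * x)); rewrite normrN; lra.
have [->|x0] := eqVneq x 0; first by rewrite normr0 !mulr0 addr0.
have xp : 0 < `|x| by rewrite normr_gt0.
pose r' := Num.min 1 (r / `|x|).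
apply: (@le0_of_small _ (x ^+ 2 * `|d|) r'); first by rewrite lt_min ltr01 divr_gt0.
move=> s /andP[s0]; rewrite le_min ler_pdivlMr// => /andP[s1 sr].
have := H (- s * x); rewrite normrM normrN (gtr0_norm s0) => /(_ sr).
have -> : `|x + - s * x| = (1 - s) * `|x|.
  have -> : x + - s * x = (1 - s) * x by ring.
  by rewrite normrM ger0_norm// subr_ge0.
have h1 : (- s * x) ^+ 2 * d <= s ^+ 2 * (x ^+ 2 * `|d|).
  have -> : (- s * x) ^+ 2 * d = s ^+ 2 * (x ^+ 2 * d) by ring.
  by rewrite ler_pM2l ?exprn_gt0// ler_wpM2l ?sqr_ge0// ler_norm.
have d0 : 0 <= s ^+ 2 * (x ^+ 2 * `|d|) by rewrite mulr_ge0 ?sqr_ge0// mulr_ge0 ?sqr_ge0.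
move=> h3; rewrite -(ler_pM2l s0) mulrA -expr2; nra.
Qed.

Context {p : nat}.
Variables (G : 'M[R]_p) (g bstar : 'cV[R]_p).
Variables (lam rad alpha tau phi eta cinf : R).
Hypothesis GT : G^T = G.
Hypothesis alpha0 : 0 < alpha.
Hypothesis tau0 : 0 <= tau.
Hypothesis rsc : forall v, alpha * dotp v v - tau * l1norm v ^+ 2 <= dotp v (G *m v).
Hypothesis phi0 : 0 <= phi.
Hypothesis noise : forall j, `|(G *m bstar - g) j 0| <= phi.
Hypothesis lam0 : 0 < lam.
Hypothesis rad0 : 0 < rad.
Hypothesis bstar_rad : l1norm bstar <= rad / 2.
Let S := supp bstar.
Hypothesis tauS : 4 * tau * #|S|%:R <= alpha.
Hypothesis phi_lam : 4 * phi <= lam.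
Hypothesis phi_eta : (1 + eta) * phi <= lam * ((1 - eta) / 2).
Hypothesis tau_lam : 16 * tau * rad <= lam * (1 - eta).

Lemma sum_split (f : 'I_p -> R) :
  \sum_j f j = \sum_(j in S) f j + \sum_(j in ~: S) f j.
Proof.
by rewrite (bigID (mem S))/=; congr (_ + _); apply: eq_bigl => j; rewrite !inE.
Qed.

Lemma l1norm_split (v : 'cV[R]_p) :
  l1norm v = \sum_(j in S) `|v j 0| + \sum_(j in ~: S) `|v j 0|.
Proof. exact: sum_split. Qed.

(* The curvature deficit is absorbed by the l2 part on S, since #|S| tau is
   small, and by the l1 part off S, since the l1 norm is at most 2 rad. *)
Lemma rsc_radius (v : 'cV[R]_p) : l1norm v <= 2 * rad ->
  alpha / 2 * dotp v v - lam * ((1 - eta) / 2) * \sum_(j in ~: S) `|v j 0|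
    <= dotp v (G *m v).
Proof.
move=> vr; apply: le_trans (rsc v).
have := sum_norm_sqr_le S v; have := l1norm_split v; move: vr.
set a := \sum_(j in S) _; set b := \sum_(j in ~: S) _; set L := l1norm v.
have a0 : 0 <= a by rewrite sumr_ge0.
have b0 : 0 <= b by rewrite sumr_ge0.
have := dotpvv_ge0 v; set q := dotp v v => q0 Lr Lab aS.
(* [(a + b)^2 <= 2 a^2 + 2 b (a + b)], and the last factor [a + b] is traded for [2 rad]: the
   deficit becomes linear in the mass off S. *)
have h1 : tau * L ^+ 2 <= tau * (2 * a ^+ 2 + 4 * rad * b).
  apply: ler_wpM2l => //; rewrite Lab.
  have := sqr_ge0 (a - b); have : b * (a + b) <= b * (2 * rad) by rewrite ler_wpM2l// -Lab.
  nra.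
have h2 : 4 * tau * a ^+ 2 <= alpha * q.
  apply: (@le_trans _ _ (4 * tau * (#|S|%:R * q))); last by rewrite mulrA ler_wpM2r.
  by rewrite ler_wpM2l// mulr_ge0.
have h3 : 16 * tau * rad * b <= lam * (1 - eta) * b by rewrite ler_wpM2r.
have h4 : 0 <= tau * rad * b by rewrite mulr_ge0// mulr_ge0// ltW.
lra.
Qed.

Section Certificate.
Variable bhat : 'cV[R]_p.
Hypothesis bhat_rad : l1norm bhat <= rad.
Hypothesis bhatS : supp bhat \subset S.
Let z := - lam^-1 *: (G *m bhat - g).
Hypothesis zS : forall j, j \in S -> `|z j 0| <= 1.
Hypothesis zb : forall j, z j 0 * bhat j 0 = `|bhat j 0|.
Hypothesis zSc : forall j, j \notin S -> `|z j 0| <= (1 + eta) / 2.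
Hypothesis eta1 : eta < 1.

Lemma gradE : G *m bhat - g = - lam *: z.
Proof. by rewrite /z scalerA mulrNN mulfV ?gt_eqF// scale1r. Qed.

(** The slack [1 - (1 + eta) / 2] of [z] off S is kept as a multiple of the mass off S; it will
    cancel the negative term of [rsc_radius]. *)
Lemma dotp_z_le (b : 'cV[R]_p) :
  dotp z b + (1 - eta) / 2 * \sum_(j in ~: S) `|b j 0| <= l1norm b.
Proof.
rewrite dotpE sum_split l1norm_split -addrA; apply: lerD.
  apply: ler_sum => j jS; apply: le_trans (ler_norm _) _.
  by rewrite normrM -[leRHS]mul1r ler_wpM2r// zS.
rewrite mulr_sumr -big_split; apply: ler_sum => j; rewrite inE => jS /=.
apply: (@le_trans _ _ ((1 + eta) / 2 * `|b j 0| + (1 - eta) / 2 * `|b j 0|)).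
  rewrite lerD2r; apply: le_trans (ler_norm _) _.
  by rewrite normrM ler_wpM2r// zSc.
by lra.
Qed.

Lemma dotp_z_bhat : dotp z bhat = l1norm bhat.
Proof. by rewrite dotpE; apply: eq_bigr => j _. Qed.

Lemma sum_off_support (b : 'cV[R]_p) :
  \sum_(j in ~: S) `|(b - bhat) j 0| = \sum_(j in ~: S) `|b j 0|.
Proof.
apply: eq_bigr => j; rewrite inE => jS; rewrite !mxE.
suff -> : bhat j 0 = 0 by rewrite subr0.
apply/eqP/negPn/negP => b0; move: jS; rewrite (fintype.subsetP bhatS)//.
by rewrite inE.
Qed.

Lemma diff_rad b : l1norm b <= rad -> l1norm (b - bhat) <= 2 * rad.
Proof. by move=> br; rewrite (le_trans (l1normD _ _))// l1normN mulr2n mulrDl mul1r lerD. Qed.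

Lemma certificate_stationary : stationary_point G g lam rad bhat.
Proof.
split => // b' _; rewrite gradient_loss// gradE dotpZl penalty_slopeE mulNr addrC.
rewrite subr_ge0 ler_pM2l//; apply: le_l1slope => // j.
have [/zS//|jS] := boolP (j \in S).
by rewrite (le_trans (zSc jS))//; have := eta1; lra.
Qed.

(** With [nu = b - bhat], testing the stationarity of [b] against [bhat] gives
    [nu^T G nu <= lam (<z,b> - |b|_1)], since [|bhat|_1] cancels. The right side is at most
    [- lam (1 - eta) / 2] times the mass of [b] off S, the very term lost in [rsc_radius], so that
    [alpha / 2 |nu|_2^2 <= 0]. *)
Lemma certificate_unique b : stationary_point G g lam rad b -> b = bhat.
Proof.
move=> [br] /(_ bhat bhat_rad); rewrite gradient_loss// penalty_slopeE => h.
have h1 := l1slope_le b (bhat - b); rewrite subrKC in h1.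
have h2 : lam * l1slope b (bhat - b) <= lam * (l1norm bhat - l1norm b) by rewrite ler_pM2l.
have E : G *m b - g = G *m (b - bhat) - lam *: z.
  by rewrite -scaleNr -gradE mulmxBr addrA subrK.
have h3 := rsc_radius (diff_rad br); rewrite sum_off_support in h3.
have h4 := dotp_z_le b.
have E2 : dotp (G *m b - g) (bhat - b) =
    lam * (dotp z b - l1norm bhat) - dotp (b - bhat) (G *m (b - bhat)).
  have -> : dotp z b - l1norm bhat = dotp z (b - bhat).
    by rewrite dotpDr dotpNr dotp_z_bhat.
  rewrite E -(opprB b bhat); set nu := b - bhat.
  rewrite dotpNr [dotp (_ - _) _]dotpDl dotpNl [dotp (_ *: z) _]dotpZl.
  by rewrite (dotpC (G *m nu)); ring.
rewrite E2 in h.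
have h5 : lam * (dotp z b + (1 - eta) / 2 * (\sum_(j in ~: S) `|b j 0|)) <= lam * l1norm b.
  by rewrite ler_pM2l.
have : alpha / 2 * dotp (b - bhat) (b - bhat) <= 0 by lra.
rewrite pmulr_rle0 ?divr_gt0// => h6; apply/eqP; rewrite -subr_eq0; apply/eqP.
by apply: dotpvv_eq0; apply/eqP; rewrite eq_le h6 dotpvv_ge0.
Qed.

(** The same cancellation in the exact expansion at [bhat]; the curvature now enters with factor
    1/2, so half of the slack suffices. *)
Lemma certificate_optimum : global_optimum G g lam rad bhat.
Proof.
split => // b br; rewrite -[in loss G g b](subrKC bhat b) lossD// gradE dotpZl.
rewrite dotpDr dotpNr dotp_z_bhat /penalty.
have h3 := rsc_radius (diff_rad br); rewrite sum_off_support in h3.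
have h4 : lam * (dotp z b + (1 - eta) / 2 * (\sum_(j in ~: S) `|b j 0|)) <= lam * l1norm b.
  by rewrite ler_pM2l// dotp_z_le.
have h5 : 0 <= alpha / 2 * dotp (b - bhat) (b - bhat).
  by rewrite mulr_ge0 ?dotpvv_ge0// divr_ge0// ltW.
have h6 : 0 <= lam * ((1 - eta) / 2) * \sum_(j in ~: S) `|b j 0|.
  by rewrite mulr_ge0 ?sumr_ge0// mulr_ge0 ?ltW// divr_gt0// subr_gt0.
lra.
Qed.

End Certificate.

(** Links the blocks of the hypotheses, which are indexed by ordinals, to the full matrix acting on
    vectors supported in S; [A] is S or its complement. *)
Lemma submx_of_mul (M : 'M[R]_p) (A : {set 'I_p}) (v : 'cV[R]_p) i :
  supp v \subset S ->
  (submx_of M A S *m \col_(k < #|S|) v (enum_val k) 0) i 0 = (M *m v) (enum_val i) 0.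
Proof.
move=> vS; rewrite !mxE [RHS](bigID (mem S))/= [X in _ + X]big1 ?addr0; last first.
  move=> j jS; suff -> : v j 0 = 0 by rewrite mulr0.
  apply/eqP/negPn/negP => b0; move: jS; rewrite (fintype.subsetP vS)//.
  by rewrite inE.
rewrite [RHS]big_enum_val /=; apply: eq_bigr => k _; by rewrite !mxE.
Qed.

Lemma restricted_kkt bhat : l1norm bhat <= rad -> supp bhat \subset S ->
  (forall b', l1norm b' <= rad -> supp b' \subset S ->
    loss G g bhat + penalty lam bhat <= loss G g b' + penalty lam b') ->
  forall j, j \in S -> `|(G *m bhat - g) j 0| <= lam /\
    (G *m bhat - g) j 0 * bhat j 0 = - (lam * `|bhat j 0|).
Proof.
move=> br bS bmin.
have [[[[[H1 H2] H3] H4] H5] H6] := (bstar_rad, rad0, tauS, alpha0, phi_lam, lam0).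
(* Comparison with [bstar]: since [phi <= lam / 4] and the form is nonnegative on vectors supported
   in S, [|bhat|_1 <= |bstar|_1 + (|bhat|_1 + |bstar|_1) / 4], that is [|bhat|_1 <= 5/3 |bstar|_1].
   The margin [rad / 6] keeps the ball constraint inactive under the coordinate perturbations
   below. *)
have bhat56 : l1norm bhat <= 5 / 6 * rad.
  have h1 : l1norm bstar <= rad by lra.
  have := bmin _ h1 (subxx _); rewrite -[in loss G g bhat](subrKC bstar bhat).
  rewrite lossD//; set nu := bhat - bstar; rewrite /penalty.
  have h2 : `|dotp (G *m bstar - g) nu| <= phi * l1norm nu by exact: holder.
  have h3 : - dotp (G *m bstar - g) nu <= phi * l1norm nu.
    by rewrite (le_trans (ler_norm _))// normrN.
  have h4 : 0 <= dotp nu (G *m nu).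
    apply: le_trans (rsc nu); rewrite subr_ge0.
    have -> : l1norm nu = \sum_(j in S) `|nu j 0|.
      rewrite l1norm_split [X in _ + X]big1 ?addr0// => j; rewrite inE => jS.
      rewrite !mxE; suff [-> ->] : bhat j 0 = 0 /\ bstar j 0 = 0 by rewrite subr0 normr0.
      split; apply/eqP/negPn/negP => b0; move: jS; last by rewrite inE b0.
      by rewrite (fintype.subsetP bS)// inE.
    apply: (@le_trans _ _ (tau * (#|S|%:R * dotp nu nu))).
      by rewrite ler_wpM2l// sum_norm_sqr_le.
    rewrite mulrA ler_wpM2r ?dotpvv_ge0//.
    have : 0 <= tau * #|S|%:R by rewrite mulr_ge0.
    lra.
  have h5 : l1norm nu <= l1norm bhat + l1norm bstar.
    by rewrite (le_trans (l1normD _ _))// l1normN.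
  have h6 : phi * l1norm nu <= lam / 4 * (l1norm bhat + l1norm bstar).
    apply: (@le_trans _ _ (lam / 4 * l1norm nu)).
      by rewrite ler_wpM2r ?l1norm_ge0//; lra.
    by rewrite ler_wpM2l// divr_ge0// ltW.
  move=> h7.
  have : lam * l1norm bhat <= lam * (5 / 3 * l1norm bstar) by lra.
  rewrite ler_pM2l//; lra.
move=> j jS.
apply: (@scalar_kkt _ (G j j) lam _ (rad / 6)) => //; first by rewrite divr_gt0.
move=> t tr.
have := bmin (bhat + t *: delta_mx j 0); rewrite lossD// /penalty => h.
have e1 : l1norm (delta_mx j 0 : 'cV[R]_p) = 1.
  rewrite /l1norm (bigD1 j)//= mxE !eqxx normr1 big1 ?addr0// => i ij.
  by rewrite mxE (negPf ij) normr0.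
have h1 : l1norm (bhat + t *: delta_mx j 0) <= rad.
  by rewrite (le_trans (l1normD _ _))// l1normZ e1 mulr1; lra.
have h2 : supp (bhat + t *: delta_mx j 0) \subset S.
  apply/fintype.subsetP => i; rewrite inE; have [->//|ij] := eqVneq i j.
  rewrite !mxE (negPf ij) mulr0 addr0 => bi; apply: (fintype.subsetP bS).
  by rewrite inE.
have h3 : l1norm (bhat + t *: delta_mx j 0) - l1norm bhat = `|bhat j 0 + t| - `|bhat j 0|.
  rewrite -sumrB (bigD1 j)//= !mxE !eqxx mulr1 big1 ?addr0// => i ij.
  by rewrite !mxE (negPf ij) mulr0 addr0 subrr.
have := h h1 h2; rewrite -h3 -scalemxAr !dotpZr dotpZl dotp_delta.
have -> : dotp (delta_mx j 0) (G *m delta_mx j 0) = G j j.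
  by rewrite dotpC dotp_delta -colE mxE.
lra.
Qed.

(** On S, [G nu] is a difference of two gradients, bounded by [lam + phi]. Applying the inverse of
    [GSS] bounds the error; applying [GScS *m invmx GSS] bounds [G nu] off S by [eta (lam + phi)],
    and [phi_eta] then leaves [|z_j| <= (1 + eta) / 2] there. *)
Lemma primal_dual_witness (GSS := submx_of G S S) (GScS := submx_of G (~: S)%SET S) :
  eta < 1 -> GSS \in unitmx -> linf_opnorm (invmx GSS) <= cinf ->
  linf_opnorm (GScS *m invmx GSS) <= eta ->
  exists bhat : 'cV[R]_p,
    [/\ stationary_point G g lam rad bhat,
        forall b, stationary_point G g lam rad b -> b = bhat,
        global_optimum G g lam rad bhat,
        supp bhat \subset S &
        linfnorm (bhat - bstar) <= cinf * (phi + lam)].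
Proof.
move=> eta1 GSSu Hcinf Heta.
have cinf0 : 0 <= cinf := le_trans (linf_opnorm_ge0 _) Hcinf.
have eta0 : 0 <= eta := le_trans (linf_opnorm_ge0 _) Heta.
have [bhat [br bS bmin]] := min_restricted G g lam S (ltW rad0).
have kkt := restricted_kkt br bS bmin.
pose nu := bhat - bstar.
have nuS : supp nu \subset S.
  apply/fintype.subsetP => j; rewrite inE; apply: contraR => jS; rewrite !mxE.
  have -> : bhat j 0 = 0.
    apply/eqP/negPn/negP => b0; move: jS; rewrite (fintype.subsetP bS)//.
    by rewrite inE.
  by move: jS; rewrite inE negbK => /eqP ->; rewrite subr0.
pose nuc := \col_(k < #|S|) nu (enum_val k) 0.
pose rS := GSS *m nuc.
have GnuE : G *m nu = (G *m bhat - g) - (G *m bstar - g).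
  by rewrite mulmxBr opprB addrACA [- g + _]addrC -addrACA subrr addr0 addrC.
have rSle j : `|rS j 0| <= lam + phi.
  rewrite submx_of_mul// GnuE mxE (le_trans (ler_normD _ _))// lerD//.
    by apply: (kkt _ (enum_valP j)).1.
  by rewrite mxE normrN noise.
have nucE : nuc = invmx GSS *m rS by rewrite mulKmx.
have lp0 : 0 <= lam + phi by rewrite addr_ge0// ltW.
have nule j : `|nu j 0| <= cinf * (phi + lam).
  have [jS|jS] := boolP (j \in S); last first.
    have -> : nu j 0 = 0.
      by apply/eqP/negPn/negP => b0; move: jS; rewrite (fintype.subsetP nuS)// inE.
    by rewrite normr0 mulr_ge0// addrC.
  have -> : nu j 0 = nuc (enum_rank_in jS j) 0 by rewrite [RHS]mxE enum_rankK_in.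
  rewrite nucE (le_trans (linf_opnorm_mul _ _ rSle))// addrC.
  by rewrite ler_wpM2r// addrC.
exists bhat.
have zE j : (- lam^-1 *: (G *m bhat - g)) j 0 = - lam^-1 * (G *m bhat - g) j 0.
  by rewrite mxE.
have nz j : `|- lam^-1 * (G *m bhat - g) j 0| = `|(G *m bhat - g) j 0| / lam.
  by rewrite normrM normrN (gtr0_norm (x := lam^-1)) ?invr_gt0// mulrC.
have zS j : j \in S -> `|(- lam^-1 *: (G *m bhat - g)) j 0| <= 1.
  by move=> /kkt[h _]; rewrite zE nz ler_pdivrMr// mul1r.
have zb j : (- lam^-1 *: (G *m bhat - g)) j 0 * bhat j 0 = `|bhat j 0|.
  have [/kkt[_ h]|jS] := boolP (j \in S).
    by rewrite zE -mulrA h mulrNN mulKf// gt_eqF.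
  have -> : bhat j 0 = 0.
    by apply/eqP/negPn/negP => b0; move: jS; rewrite (fintype.subsetP bS)// inE.
  by rewrite mulr0 normr0.
have zSc j : j \notin S -> `|(- lam^-1 *: (G *m bhat - g)) j 0| <= (1 + eta) / 2.
  move=> jS'; have jS : j \in ~: S by rewrite finset.in_setC.
  rewrite zE nz ler_pdivrMr//.
  have -> : (G *m bhat - g) j 0 = (G *m nu) j 0 + (G *m bstar - g) j 0.
    by transitivity ((G *m nu + (G *m bstar - g)) j 0); [rewrite GnuE subrK | rewrite mxE].
  have h1 : `|(G *m nu) j 0| <= eta * (lam + phi).
    have <- : (GScS *m nuc) (enum_rank_in jS j) 0 = (G *m nu) j 0.
      by rewrite submx_of_mul// enum_rankK_in.
    rewrite nucE mulmxA (le_trans (linf_opnorm_mul _ _ rSle))//.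
    by rewrite ler_wpM2r.
  rewrite (le_trans (ler_normD _ _))//; have := noise j; have := phi_eta; lra.
split => //.
- exact: certificate_stationary.
- exact: certificate_unique.
- exact: certificate_optimum.
- by apply: bigmax_le => [|j _]; [rewrite mulr_ge0// addrC | exact: nule].
Qed.

End PrimalDualWitness.

(** * From sparse to dense quadratic forms *)

Section Maurey.
Context {R : realType} {p : nat}.

(** The vertices of the unit l1-ball, [true] coding the minus sign; the index type is finite, so
    that tuples can be counted in a union bound. *)
Definition signed_basis (a : bool * 'I_p) : 'cV[R]_p :=
  (-1) ^+ a.1 *: delta_mx a.2 0.

Definition signed_sum (s : seq (bool * 'I_p)) : 'cV[R]_p :=
  \sum_(a <- s) signed_basis a.

Lemma signed_basis_quad (N : 'M[R]_p) a :
  dotp (signed_basis a) (N *m signed_basis a) = N a.2 a.2.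
Proof.
rewrite -scalemxAr dotpZl dotpZr mulrA -expr2 sqrr_sign mul1r dotpC dotp_delta.
by rewrite -colE mxE.
Qed.

(* Average the quadratic form at u0 + (sum of m independent random signed basis
   vectors with mean v): the cross terms only see the mean v, and the m
   diagonal terms only see the diagonal of N. *)
Lemma empirical_quad (N : 'M[R]_p) (v : 'cV[R]_p) m (u0 : 'cV[R]_p) :
  N^T = N -> l1norm v = 1 ->
  (forall s, size s = m ->
     0 <= dotp (u0 + signed_sum s) (N *m (u0 + signed_sum s))) ->
  0 <= dotp u0 (N *m u0) + 2 * m%:R * dotp u0 (N *m v)
       + m%:R * (m%:R - 1) * dotp v (N *m v) + m%:R * \sum_j `|v j 0| * N j j.
Proof.
(* The average is taken by induction on the number of draws, without a probability space: [u0] is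
   generalized to absorb the first draw. *)
move=> NT v1; elim: m u0 => [|m IH] u0 H.
  by have := H [::] erefl; rewrite /signed_sum big_nil addr0 !(mulr0, mul0r, addr0).
(* A draw yields [a j], which carries the sign of [v_j], with probability [|v_j|]; the weights sum
   to 1 and the mean is [v]. *)
pose a j := (v j 0 < 0, j).
have vE : v = \sum_j `|v j 0| *: signed_basis (a j).
  apply/matrixP => i k; rewrite ord1 summxE (bigD1 i)//= !mxE !eqxx mulr1 big1 ?addr0.
    by rewrite [in LHS](numEsign (v i 0)) ?num_real// mulrC.
  by move=> j ji; rewrite !mxE eq_sym (negPf ji) !mulr0.
have step j : 0 <= `|v j 0| *
    (dotp u0 (N *m u0) + 2 * dotp u0 (N *m signed_basis (a j)) + N j j
     + 2 * m%:R * (dotp u0 (N *m v) + dotp (signed_basis (a j)) (N *m v))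
     + m%:R * (m%:R - 1) * dotp v (N *m v) + m%:R * \sum_j `|v j 0| * N j j).
  rewrite mulr_ge0//.
  have -> : N j j = dotp (signed_basis (a j)) (N *m signed_basis (a j)).
    by rewrite signed_basis_quad.
  rewrite -dotp_quadD// -dotpDl; apply: IH => s sm.
  have := H (a j :: s); rewrite /= sm => /(_ erefl).
  by rewrite /signed_sum big_cons addrA.
have := sumr_ge0 (index_enum _) (P := predT) (fun j _ => step j).
set c1 := dotp u0 _; set c2 := dotp u0 (N *m v); set c3 := dotp v _.
set c4 := \sum_j `|v j 0| * N j j => h.
have e1 : \sum_j `|v j 0| * dotp u0 (N *m signed_basis (a j)) = c2.
  rewrite /c2 [in RHS]vE mulmx_sumr dotp_sumr.
  by apply: eq_bigr => j _; rewrite -[in RHS]scalemxAr [RHS]dotpZr.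
have e2 : \sum_j `|v j 0| * dotp (signed_basis (a j)) (N *m v) = c3.
  rewrite /c3 (dotpC v) [X in dotp _ X]vE dotp_sumr.
  by apply: eq_bigr => j _; rewrite [RHS]dotpZr (dotpC (N *m v)).
have : \sum_j (`|v j 0| * (c1 + 2 * m%:R * c2 + m%:R * (m%:R - 1) * c3 + m%:R * c4) +
     (2 * (`|v j 0| * dotp u0 (N *m signed_basis (a j))) + `|v j 0| * N j j
     + 2 * m%:R * (`|v j 0| * dotp (signed_basis (a j)) (N *m v)))) >= 0.
  apply: le_trans h _; apply: ler_sum => j _; rewrite le_eqVlt; apply/orP; left.
  by apply/eqP; ring.
rewrite !big_split /= -mulr_suml -!mulr_sumr e1 e2 -/(l1norm v) v1 -/c4 => {}h.
apply: le_trans h _; rewrite le_eqVlt; apply/orP; left; apply/eqP.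
by rewrite -natr1; ring.
Qed.

(** For [|v|_1 = 1] and [u0 = 0], [empirical_quad] reads [0 <= m (m - 1) v^T N v + m sum_j |v_j|
    N_jj], where the last sum is at most [D]; homogeneity does the rest. *)
Lemma quad_lower_of_sparse (N : 'M[R]_p) (D : R) m (v : 'cV[R]_p) :
  N^T = N -> (1 < m)%N -> (forall j, N j j <= D) ->
  (forall s, size s = m -> 0 <= dotp (signed_sum s) (N *m signed_sum s)) ->
  - (D / (m%:R - 1)) * l1norm v ^+ 2 <= dotp v (N *m v).
Proof.
move=> NT m1 ND H.
have [v0|v0] := eqVneq (l1norm v) 0.
  have -> : v = 0.
    apply/matrixP => j i; rewrite ord1 mxE; apply/eqP; rewrite -normr_eq0.
    move/eqP: v0; rewrite psumr_eq0// => /allP /(_ j (mem_index_enum _)).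
    by [].
  by rewrite dotp0l /l1norm big1 ?expr0n ?mulr0// => j _; rewrite mxE normr0.
have L0 : 0 < l1norm v by rewrite lt_neqAle eq_sym v0 sumr_ge0.
have := @empirical_quad N ((l1norm v)^-1 *: v) m 0 NT.
rewrite l1normZ gtr0_norm ?invr_gt0// mulVf// => /(_ erefl).
have H0 s : size s = m ->
    0 <= dotp (0 + signed_sum s) (N *m (0 + signed_sum s)).
  by rewrite !add0r; exact: H.
move=> /(_ H0); rewrite !dotp0l mulr0 !add0r -scalemxAr dotpZl dotpZr.
set q := dotp v _; set L := l1norm v => h.
have h1 : \sum_j `|(L^-1 *: v) j 0| * N j j <= D.
  have -> : D = \sum_j `|(L^-1 *: v) j 0| * D.
    rewrite -mulr_suml (_ : \sum_j _ = 1) ?mul1r//.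
    by rewrite -/(l1norm (L^-1 *: v)) l1normZ gtr0_norm ?invr_gt0// mulVf.
  by apply: ler_sum => j _; rewrite ler_wpM2l.
have m0 : 0 < m%:R :> R by rewrite ltr0n ltnW.
have m10 : 0 < m%:R - 1 :> R by rewrite subr_gt0 ltr1n.
have : 0 <= m%:R * ((m%:R - 1) * (L^-1 * (L^-1 * q)) + D).
  by apply: le_trans h _; rewrite [leRHS]mulrDr [X in _ <= X + _]mulrA lerD2l ler_pM2l.
rewrite pmulr_rge0// => h2.
have : 0 <= L ^+ 2 / (m%:R - 1) * ((m%:R - 1) * (L^-1 * (L^-1 * q)) + D).
  by rewrite mulr_ge0// divr_ge0 ?sqr_ge0// ltW.
have -> : L ^+ 2 / (m%:R - 1) * ((m%:R - 1) * (L^-1 * (L^-1 * q)) + D) =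
   q - - (D / (m%:R - 1)) * L ^+ 2 by field; rewrite v0 gt_eqF.
by rewrite subr_ge0.
Qed.

End Maurey.

(** * Independence and expectations *)

Section TransferIntegral.
Import HBNNSimple.
Context d (T : measurableType d) (R : realType) (mu : {measure set T -> \bar R}).
Context d' (T' : measurableType d') (X : T -> T').
Hypothesis mX : measurable_fun setT X.
Variables (G1 G2 : T -> R).
Hypotheses (mG1 : measurable_fun setT G1) (mG2 : measurable_fun setT G2).
Hypotheses (G1_ge0 : forall x, 0 <= G1 x) (G2_ge0 : forall x, 0 <= G2 x).

Local Lemma integral_mul_nnsfun (G : T -> R) (h : {nnsfun T' >-> R}) :
  measurable_fun setT G -> (forall x, 0 <= G x) ->
  (\int[mu]_x (G x * h (X x))%:E =
   \sum_(k \in range h) \int[mu]_x (k * (G x * \1_(h @^-1` [set k]) (X x)))%:E)%E.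
Proof.
move=> mG G0.
under eq_integral => x _.
  rewrite fimfunE fsbig_finite//= mulr_sumr -fsbig_finite//= -fsumEFin//=.
  under eq_fsbigr do rewrite mulrCA.
  over.
rewrite ge0_integral_fsum//.
- move=> k; apply/measurable_EFinP; apply: measurable_funM => //.
  apply: measurable_funM => //; apply: measurableT_comp => //.
- move=> k x _; rewrite lee_fin mulrCA mulr_ge0//.
  by have := nnfun_muleindic_ge0 h k (X x); rewrite -EFinM lee_fin.
Qed.

(** The hypothesis says, without conditioning, that [G1] and [G2] have the same conditional
    expectation given [X]. It passes from indicators to simple functions, then to [f] by monotone
    convergence. *)
Lemma eq_integral_mul_comp (f : T' -> R) :
  measurable_fun setT f -> (forall y, 0 <= f y) ->
  (forall A, measurable A ->
    \int[mu]_x (G1 x * \1_A (X x))%:E = \int[mu]_x (G2 x * \1_A (X x))%:E)%E ->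
  (\int[mu]_x (G1 x * f (X x))%:E = \int[mu]_x (G2 x * f (X x))%:E)%E.
Proof.
move=> mf f0 H.
have mEf : measurable_fun setT (EFin \o f) by exact/measurable_EFinP.
pose h := nnsfun_approx measurableT mEf.
have mhX n : measurable_fun setT (fun x => h n (X x)).
  by apply: measurableT_comp => //; exact: measurable_funP.
have approx (G : T -> R) : measurable_fun setT G -> (forall x, 0 <= G x) ->
    (\int[mu]_x (G x * f (X x))%:E = limn (fun n => \int[mu]_x (G x * h n (X x))%:E))%E.
  move=> mG G0; rewrite -monotone_convergence//.
  - apply: eq_integral => x _; apply/esym/cvg_lim => //.
    under eq_fun do rewrite EFinM; rewrite EFinM.
    apply: cvgeZl => //.
    by apply: (@cvg_nnsfun_approx _ _ _ _ measurableT _ mEf) => // y _; rewrite lee_fin.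
  - by move=> n; apply/measurable_EFinP; exact: measurable_funM.
  - by move=> n x _; rewrite lee_fin mulr_ge0.
  - move=> x _ m n mn; rewrite lee_fin ler_wpM2l//.
    exact/lefP/nd_nnsfun_approx.
rewrite !approx//; congr (limn _); apply/funext => n.
rewrite !integral_mul_nnsfun//; apply: eq_fsbigr => k _.
have [k0|k0] := leP 0 k; last first.
  rewrite preimage_nnfun0//; apply: eq_integral => x _.
  by rewrite indic0 !mulr0.
have mk : measurable (h n @^-1` [set k]).
  by rewrite -[X in measurable X]setTI; exact: measurable_funP.
have mind : measurable_fun setT (fun x => \1_(h n @^-1` [set k]) (X x) : R).
  by apply: measurableT_comp => //; exact: measurable_indic.
under eq_integral do rewrite EFinM.
under [RHS]eq_integral do rewrite EFinM.
rewrite !ge0_integralZl_EFin//.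
- by rewrite H.
- by move=> x _; rewrite lee_fin mulr_ge0// indicE ler0n.
- by apply/measurable_EFinP; exact: measurable_funM.
- by move=> x _; rewrite lee_fin mulr_ge0// indicE ler0n.
- by apply/measurable_EFinP; exact: measurable_funM.
Qed.

End TransferIntegral.

Section IndependentProducts.
Context d (T : measurableType d) (R : realType) (P : probability T R).

Lemma measurable_prod_fun (I : Type) (r : seq I) (Q : pred I) (f : I -> T -> R) :
  (forall i, measurable_fun setT (f i)) ->
  measurable_fun setT (fun x => \prod_(i <- r | Q i) f i x).
Proof.
move=> mf; elim: r => [|i r IH].
  by under eq_fun do rewrite big_nil; exact: measurable_cst.
under eq_fun do rewrite big_cons; case: (Q i) => //.
exact: measurable_funM.
Qed.

Lemma measurable_comp_indic d' (T' : measurableType d') (X : T -> T') (A : set T') :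
  measurable_fun setT X -> measurable A ->
  measurable_fun setT (fun x => \1_A (X x) : R).
Proof. by move=> mX mA; apply: measurableT_comp => //; exact: measurable_indic. Qed.

Lemma measurable_preimage d' (T' : measurableType d') (X : T -> T') (A : set T') :
  measurable_fun setT X -> measurable A -> measurable (X @^-1` A).
Proof. by move=> mX mA; rewrite -[X in measurable X]setTI; exact: mX. Qed.

Lemma integral_indicT (D : set T) : measurable D ->
  (\int[P]_x (\1_D x)%:E = P D)%E.
Proof. by move=> mD; rewrite integral_indic// setIT. Qed.

(* The functions [f i] replace the indicators of the product rule one by one. *)
Lemma integral_prod_independent d' (T' : measurableType d') n
    (X : 'I_n -> T -> T') (f : 'I_n -> T' -> R) (e : 'I_n -> R) :
  (forall i, measurable_fun setT (X i)) -> independent_family P X ->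
  (forall i, measurable_fun setT (f i)) -> (forall i y, 0 <= f i y) ->
  (forall i, \int[P]_x (f i (X i x))%:E = (e i)%:E)%E ->
  (\int[P]_x (\prod_i f i (X i x))%:E = (\prod_i e i)%:E)%E.
Proof.
move=> mX indep mf f0 ef.
have e0 i : 0 <= e i by rewrite -lee_fin -ef integral_ge0// => x _; rewrite lee_fin.
(* After [m] replacements the factors of index below [m] are the [f i], with integral [e i]; the
   others are still indicators. *)
pose F m (A : 'I_n -> set T') (i : 'I_n) (y : T') := if (i < m)%N then f i y else \1_(A i) y.
pose c m (A : 'I_n -> set T') (i : 'I_n)  :=
  if (i < m)%N then e i else fine (P (X i @^-1` A i)).
have c0 m A i : 0 <= c m A i by rewrite /c; case: ifP => // _; rewrite fine_ge0.
have F0 m A i y : 0 <= F m A i y by rewrite /F; case: ifP => // _; rewrite indicE ler0n.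
have mF m A i : (forall i, measurable (A i)) -> measurable_fun setT (fun x => F m A i (X i x)).
  move=> mA; rewrite /F; case: (i < m)%N; last exact: measurable_comp_indic.
  exact: measurableT_comp.
suff H m A : (m <= n)%N -> (forall i, measurable (A i)) ->
    (\int[P]_x (\prod_i F m A i (X i x))%:E = (\prod_i c m A i)%:E)%E.
  have := H n (fun=> setT) (leqnn n) (fun=> measurableT).
  under eq_integral => x _ do under eq_bigr => i _ do rewrite /F ltn_ord.
  by under [in RHS]eq_bigr => i _ do rewrite /c ltn_ord.
elim: m A => [|m IH] A mn mA.
  transitivity (P (\bigcap_(i in [set: 'I_n]) X i @^-1` A i)).
    rewrite -integral_indicT; last first.
      by apply: fin_bigcap_measurable => // i _; exact: measurable_preimage.
    apply: eq_integral => x _; congr EFin.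
    rewrite (eq_bigr (fun i => \1_(A i) (X i x)))//.
    rewrite indicE; case: (boolP (x \in _)) => [|]; rewrite ?inE ?notin_setE /=.
      by move=> h; rewrite big1// => i _; rewrite indicE mem_set//; exact: h.
    move=> /existsNP[i /not_implyP[_ h]].
    by rewrite (bigD1 i)//= indicE memNset// mul0r.
  rewrite indep// -prodEFin.
  by apply: eq_bigr => i _; rewrite /c ltn0 fineK// fin_num_measure//;
    exact: measurable_preimage.
pose i0 := Ordinal mn.
pose G x := \prod_(i | i != i0) F m A i (X i x).
pose C := \prod_(i | i != i0) c m A i.
have mG : measurable_fun setT G by apply: measurable_prod_fun => i; exact: mF.
have G0 x : 0 <= G x by exact: prodr_ge0.
have C0 : 0 <= C by exact: prodr_ge0.
have ltS (i : 'I_n) : i != i0 -> (i < m.+1)%N = (i < m)%N.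
  by move=> ii0; rewrite ltnS leq_eqVlt -[X in _ == X]/(nat_of_ord i0) val_eqE (negPf ii0).
have GE x : \prod_i F m.+1 A i (X i x) = G x * f i0 (X i0 x).
  rewrite (bigD1 i0)//= mulrC /F ltnSn; congr (_ * _).
  by apply: eq_bigr => i ii0; rewrite ltS.
have CE : \prod_i c m.+1 A i = C * e i0.
  rewrite (bigD1 i0)//= mulrC /c ltnSn; congr (_ * _).
  by apply: eq_bigr => i ii0; rewrite ltS.
under eq_integral do rewrite GE; rewrite CE.
(* The product [G] of the other factors may be replaced by the constant [C]: tested against the
   indicator of [B] at [X i0], both have the same integral, by the induction hypothesis with [B] in
   place of [A i0]. *)
rewrite (@eq_integral_mul_comp _ _ _ _ _ _ _ (mX i0) G (cst C))//; first last.
- move=> B mB.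
  pose A' i := if i == i0 then B else A i.
  have mA' i : measurable (A' i) by rewrite /A'; case: ifP.
  transitivity (\int[P]_x (\prod_i F m A' i (X i x))%:E)%E.
    apply: eq_integral => x _; congr EFin.
    rewrite [RHS](bigD1 i0)//= [RHS]mulrC; congr (_ * _); last by rewrite /F ltnn /A' eqxx.
    by apply: eq_bigr => i ii0; rewrite /F /A' (negPf ii0).
  rewrite IH//; last exact: ltnW.
  under [in RHS]eq_integral do rewrite /= EFinM.
  rewrite ge0_integralZl_EFin//; last first.
    by apply/measurable_EFinP; exact: measurable_comp_indic.
  have -> : (\int[P]_x (\1_B (X i0 x))%:E = P (X i0 @^-1` B))%E.
    by rewrite -integral_indicT//; exact: measurable_preimage.
  rewrite -(@fineK _ (P (X i0 @^-1` B))) -?EFinM ?fin_num_measure//;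
    last exact: measurable_preimage.
  congr EFin; rewrite [LHS](bigD1 i0)//= [LHS]mulrC; congr (_ * _);
    last by rewrite /c ltnn /A' eqxx.
  by apply: eq_bigr => i ii0; rewrite /c /A' (negPf ii0).
under eq_integral do rewrite /= EFinM.
rewrite ge0_integralZl_EFin ?ef -?EFinM//.
- by move=> x _; rewrite lee_fin.
- by apply/measurable_EFinP; exact: measurableT_comp.
Qed.

Lemma integral_cst_mul_indic d' (T' : measurableType d') (X : T -> T') (c : R) A :
  measurable_fun setT X -> measurable A -> 0 <= c ->
  (\int[P]_x (c * \1_A (X x))%:E = c%:E * P (X @^-1` A))%E.
Proof.
move=> mX mA c0; under eq_integral do rewrite EFinM.
rewrite ge0_integralZl_EFin//; last first.
- by apply/measurable_EFinP; exact: measurable_comp_indic.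
by rewrite -integral_indicT//; exact: measurable_preimage.
Qed.

(** The same replacement one by one, for variables with values in three different spaces. *)
Lemma integral_mul_independent3 d1 d2 d3 (T1 : measurableType d1)
    (T2 : measurableType d2) (T3 : measurableType d3)
    (X1 : T -> T1) (X2 : T -> T2) (X3 : T -> T3)
    (f1 : T1 -> R) (f2 : T2 -> R) (f3 : T3 -> R) (e1 e2 e3 : R) :
  measurable_fun setT X1 -> measurable_fun setT X2 -> measurable_fun setT X3 ->
  independent3 P X1 X2 X3 ->
  measurable_fun setT f1 -> measurable_fun setT f2 -> measurable_fun setT f3 ->
  (forall y, 0 <= f1 y) -> (forall y, 0 <= f2 y) -> (forall y, 0 <= f3 y) ->
  (\int[P]_x (f1 (X1 x))%:E = e1%:E)%E -> (\int[P]_x (f2 (X2 x))%:E = e2%:E)%E ->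
  (\int[P]_x (f3 (X3 x))%:E = e3%:E)%E ->
  (\int[P]_x (f1 (X1 x) * f2 (X2 x) * f3 (X3 x))%:E = (e1 * e2 * e3)%:E)%E.
Proof.
move=> mX1 mX2 mX3 indep mf1 mf2 mf3 f10 f20 f30 E1 E2 E3.
have e10 : 0 <= e1 by rewrite -lee_fin -E1 integral_ge0// => x _; rewrite lee_fin.
have e20 : 0 <= e2 by rewrite -lee_fin -E2 integral_ge0// => x _; rewrite lee_fin.
have step d' (T' : measurableType d') (X : T -> T') (f : T' -> R) (e c : R) (G : T -> R) :
    measurable_fun setT X -> measurable_fun setT f -> (forall y, 0 <= f y) ->
    (\int[P]_x (f (X x))%:E = e%:E)%E -> 0 <= c ->
    measurable_fun setT G -> (forall x, 0 <= G x) ->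
    (forall A, measurable A ->
      \int[P]_x (G x * \1_A (X x))%:E = c%:E * P (X @^-1` A))%E ->
    (\int[P]_x (G x * f (X x))%:E = (c * e)%:E)%E.
  move=> mX mf f0 ef c0 mG G0 H.
  rewrite (@eq_integral_mul_comp _ _ _ _ _ _ _ mX G (cst c))//; last first.
    by move=> A mA; rewrite H// -integral_cst_mul_indic.
  under eq_integral do rewrite /= EFinM.
  rewrite ge0_integralZl_EFin ?ef -?EFinM//.
  - by move=> x _; rewrite lee_fin.
  - by apply/measurable_EFinP; exact: measurableT_comp.
have mfX1 : measurable_fun setT (f1 \o X1) by exact: measurableT_comp.
have mfX2 : measurable_fun setT (f2 \o X2) by exact: measurableT_comp.
have Pfin d' (T' : measurableType d') (X : T -> T') A :
    measurable_fun setT X -> measurable A -> P (X @^-1` A) = (fine (P (X @^-1` A)))%:E.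
  by move=> mX mA; rewrite fineK// fin_num_measure//; exact: measurable_preimage.
apply: (@step _ _ X3 f3 e3 (e1 * e2)) => //; first by rewrite mulr_ge0.
- exact: measurable_funM.
- by move=> x; rewrite mulr_ge0.
move=> A3 mA3.
under eq_integral do rewrite mulrAC.
rewrite (Pfin _ _ X3)// -EFinM -mulrAC.
apply: (@step _ _ X2 f2 e2) => //; first by rewrite mulr_ge0// fine_ge0.
- by apply: measurable_funM => //; exact: measurable_comp_indic.
- by move=> x; rewrite mulr_ge0// indicE ler0n.
move=> A2 mA2.
under eq_integral do rewrite -mulrA mulrC.
rewrite (Pfin _ _ X2)// -EFinM -mulrA mulrC.
apply: (@step _ _ X1 f1 e1) => //; first by rewrite mulr_ge0// fine_ge0.
- by apply: measurable_funM => //; exact: measurable_comp_indic.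
move=> A1 mA1.
transitivity (P (X1 @^-1` A1 `&` X2 @^-1` A2 `&` X3 @^-1` A3)).
  rewrite -integral_indicT; last first.
    by apply: measurableI; [apply: measurableI|]; exact: measurable_preimage.
  apply: eq_integral => x _; congr EFin.
  rewrite mulrC mulrA mulrAC !indicE !in_setI -!mulnb !natrM.
  by [].
rewrite indep// [in LHS](Pfin _ _ X2)// [in LHS](Pfin _ _ X3)// -muleA -EFinM muleC.
by congr (_%:E * _)%E; rewrite mulrC.
Qed.

End IndependentProducts.

(** * Squares of sub-Gaussian variables *)

Section SquareExponential.
Context {R : realType}.

(** Exact to first order, so that the mean of the square will cancel in the exponential moment. Both
    signs of [y] start from [exp y - 1 <= y exp y]. *)
Lemma expR_quad_le (y : R) : expR y <= 1 + y + y ^+ 2 * expR `|y|.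
Proof.
have e0 := expR_gt0 y.
have h1 : expR y - 1 <= y * expR y.
  have := expR_ge1Dx (- y); rewrite expRN -(ler_pM2r e0) mulVf ?gt_eqF//; lra.
have [y0|y0] := leP 0 y.
  rewrite ger0_norm//; have := ler_wpM2l y0 h1; rewrite expr2; lra.
have h2 := expR_ge1Dx y.
have h3 : y ^+ 2 <= y ^+ 2 * expR `|y|.
  rewrite ler_peMr ?sqr_ge0//; have := expR_ge1Dx `|y|; have := normr_ge0 y; lra.
have : y * (expR y - 1) <= y * y by apply: ler_wnM2l; [exact: ltW | lra].
rewrite -expr2; lra.
Qed.

Lemma geometric_sum_le (r : R) n : 0 < r -> r < 1 -> \sum_(j < n) r ^+ j <= (1 - r)^-1.
Proof.
move=> r0 r1; have r10 : 0 < 1 - r by rewrite subr_gt0.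
rewrite -(ler_pM2l r10) mulfV ?gt_eqF//.
have -> : (1 - r) * \sum_(j < n) r ^+ j = 1 - r ^+ n.
  elim: n => [|n IH]; first by rewrite big_ord0 mulr0 expr0 subrr.
  by rewrite big_ord_recr mulrDr IH /= exprSr; ring.
by rewrite lerBlDr lerDl exprn_ge0// ltW.
Qed.

(* exp (x^2 / 16) is dominated by a countable mixture of the exponentials
   exp (j x), whose integrals the sub-Gaussian hypothesis controls. *)
Definition mixture (j : nat) (x : R) : R :=
  expR ((j%:R + 1) ^+ 2 / 16 - j%:R ^+ 2) * (expR (j%:R * x) + expR (- j%:R * x)).

Lemma mixture_ge0 j x : 0 <= mixture j x.
Proof. by rewrite mulr_ge0 ?addr_ge0 ?expR_ge0. Qed.

(** With [j] the integer part of [|x|], [x^2 <= (j + 1)^2] and [j^2 <= j |x|]; the prefactor of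
    [mixture j] is made for this. *)
Lemma mixture_dominates (x : R) : exists j, expR (x ^+ 2 / 16) <= mixture j x.
Proof.
exists (Num.truncn `|x|); set j := Num.truncn _.
have /andP[jx xj] : j%:R <= `|x| < j.+1%:R by exact: truncn_itv.
have h1 : expR (j%:R * `|x|) <= expR (j%:R * x) + expR (- j%:R * x).
  have [x0|x0] := leP 0 x; first by rewrite ger0_norm// lerDl expR_ge0.
  by rewrite ltr0_norm// mulrN mulNr lerDr expR_ge0.
apply: (@le_trans _ _ (expR ((j%:R + 1) ^+ 2 / 16 - j%:R ^+ 2) *
    expR (j%:R * `|x|))); last first.
  by rewrite /mixture ler_wpM2l ?expR_ge0.
rewrite -expRD ler_expR.
have h2 : j%:R * j%:R <= j%:R * `|x| :> R by rewrite ler_wpM2l.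
have h3 : x ^+ 2 <= (j%:R + 1) ^+ 2.
  by rewrite -real_normK ?num_real// ler_pXn2r// ?nnegrE ?addr_ge0// -natr1 in xj *;
    rewrite ltW.
rewrite expr2 in h2 *; lra.
Qed.

(** The sum of a geometric series: with the factor [exp (j^2 / 2)] from the sub-Gaussian bound, the
    exponent at [j] is [(j + 1)^2 / 16 - j^2 / 2 <= 1/8 - 3 j^2 / 8 <= 1/8 - 3 j / 8]. *)
Definition mixture_bound : R := 2 * expR (1 / 8) / (1 - expR (- (3 / 8))).

Lemma mixture_bound_gt0 : 0 < mixture_bound.
Proof.
by rewrite divr_gt0 ?mulr_gt0 ?expR_gt0// subr_gt0 expR_lt1; lra.
Qed.

Lemma sum_mixture_le n :
  \sum_(j < n) expR ((j%:R + 1) ^+ 2 / 16 - j%:R ^+ 2) * (2 * expR (j%:R ^+ 2 / 2))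
    <= mixture_bound.
Proof.
apply: (@le_trans _ _ (2 * expR (1 / 8) * \sum_(j < n) expR (- (3 / 8)) ^+ j)); last first.
  rewrite ler_pM2l ?mulr_gt0 ?expR_gt0//; apply: geometric_sum_le.
    exact: expR_gt0.
  by rewrite expR_lt1; lra.
rewrite mulr_sumr; apply: ler_sum => j _.
rewrite -expRM_natl mulrCA -mulrA ler_pM2l// -!expRD ler_expR.
have h : j%:R <= j%:R ^+ 2 :> R.
  by rewrite -natrX ler_nat; case: (nat_of_ord j) => // k; rewrite leq_pmulr.
have := sqr_ge0 (j%:R - 1 : R).
lra.
Qed.

Context d (T : measurableType d) (P : probability T R).

Lemma ge0_integral_fin_integrable (f : T -> R) (e : R) : measurable_fun setT f ->
  (forall x, 0 <= f x) -> (\int[P]_x (f x)%:E <= e%:E)%E ->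
  P.-integrable setT (EFin \o f).
Proof.
move=> mf f0 fe; apply/integrableP; split; first exact/measurable_EFinP.
under eq_integral do rewrite /= ger0_norm//.
by apply: le_lt_trans fe _; rewrite ltry.
Qed.

Section Standard.
Variable X : T -> R.
Hypothesis mX : measurable_fun setT X.
Hypothesis subg : forall t, (\int[P]_x (expR (t * X x))%:E <= (expR (t ^+ 2 / 2))%:E)%E.

Lemma measurable_expR_comp (f : T -> R) : measurable_fun setT f ->
  measurable_fun setT (fun x => expR (f x)).
Proof. by move=> mf; apply: measurableT_comp => //; exact: measurable_expR. Qed.

Lemma integral_mixture_le j : (\int[P]_x (mixture j (X x))%:E <=
  (expR ((j%:R + 1) ^+ 2 / 16 - j%:R ^+ 2) * (2 * expR (j%:R ^+ 2 / 2)))%:E)%E.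
Proof.
have mE t : measurable_fun setT (fun x => expR (t * X x)).
  by apply: measurable_expR_comp; exact: measurable_funM.
under eq_integral do rewrite EFinM.
rewrite ge0_integralZl_EFin ?expR_ge0//; last first.
  by apply/measurable_EFinP; exact: measurable_funD.
rewrite EFinM lee_pmul2l// ?lte_fin ?expR_gt0//.
under eq_integral do rewrite EFinD.
rewrite ge0_integralD//.
- rewrite mulr2n mulrDl mul1r EFinD; apply: leeD; first exact: subg.
  by have := subg (- j%:R); rewrite sqrrN.
- by apply/measurable_EFinP.
- by apply/measurable_EFinP.
Qed.

(** The dominating index depends on the point, so the sum over all [j] is integrated, term by
    term. *)
Lemma integral_expR_sqr_le : (\int[P]_x (expR (X x ^+ 2 / 16))%:E <= mixture_bound%:E)%E.
Proof.
have mM j : measurable_fun setT (fun x => (mixture j (X x))%:E).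
  apply/measurable_EFinP; apply: measurable_funM => //.
  by apply: measurable_funD; apply: measurable_expR_comp; exact: measurable_funM.
apply: (@le_trans _ _ (\int[P]_x (\sum_(j <oo) (mixture j (X x))%:E)))%E.
  apply: ge0_le_integral => //.
  - apply/measurable_EFinP; apply: measurable_expR_comp; apply: measurable_funM => //.
    exact: measurable_funX.
  - apply: ge0_emeasurable_sum => // j x _ _; rewrite lee_fin; exact: mixture_ge0.
  - move=> x _; have [j hj] := mixture_dominates (X x).
    apply: (@le_trans _ _ (mixture j (X x))%:E); first by rewrite lee_fin.
    apply: le_trans (nneseries_lim_ge j.+1 _) => /=.
      rewrite big_mkord big_ord_recr /= leeDr// sume_ge0// => i _.
      by rewrite lee_fin mixture_ge0.
    by move=> i _ _; rewrite lee_fin mixture_ge0.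
rewrite integral_nneseries//; last by move=> j x _; rewrite lee_fin mixture_ge0.
apply: lime_le.
  apply: is_cvg_nneseries => j _ _; apply: integral_ge0 => x _.
  by rewrite lee_fin mixture_ge0.
apply: nearW => n; rewrite big_mkord.
apply: (@le_trans _ _ (\sum_(j < n)
    (expR ((j%:R + 1) ^+ 2 / 16 - j%:R ^+ 2) * (2 * expR (j%:R ^+ 2 / 2)))%:E)%E).
  by apply: lee_sum => j _; exact: integral_mixture_le.
by rewrite sumEFin lee_fin sum_mixture_le.
Qed.

End Standard.
End SquareExponential.

Section SquareMgf.
Context {R : realType} d (T : measurableType d) (P : probability T R).

(** [64 ^+ 2] comes from [z^2 <= 64^2 exp (z / 32)]; the other factor bounds the mean of
    [exp (X^2 / 16)]. *)
Definition mgf_const : R := 64 ^+ 2 * mixture_bound.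

Lemma mgf_const_gt0 : 0 < mgf_const.
Proof. by rewrite mulr_gt0// mixture_bound_gt0. Qed.

Lemma integral_affine (f g : T -> R) (a b F G : R) :
  measurable_fun setT f -> measurable_fun setT g ->
  (forall x, 0 <= f x) -> (forall x, 0 <= g x) -> 0 <= b ->
  (\int[P]_x (f x)%:E = F%:E)%E -> (\int[P]_x (g x)%:E <= G%:E)%E ->
  (\int[P]_x (1 + a * f x + b * g x)%:E <= (1 + a * F + b * G)%:E)%E.
Proof.
move=> mf mg f0 g0 b0 fF gG.
have If : P.-integrable setT (EFin \o f).
  by apply: (@ge0_integral_fin_integrable _ _ _ _ _ F) => //; rewrite fF.
have Ig : P.-integrable setT (EFin \o g) by exact: (@ge0_integral_fin_integrable _ _ _ _ _ G).
have int1 : (\int[P]_x (EFin \o cst (1%R : R)) x = 1)%E.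
  transitivity (1 * P setT)%E; first exact: (integral_cst P measurableT 1).
  by rewrite mul1e; exact: probability_setT.
have I1 : P.-integrable setT (EFin \o cst (1 : R)).
  by apply: (@ge0_integral_fin_integrable _ _ _ _ _ 1) => //; rewrite int1.
rewrite [X in (X <= _)%E](_ : _ =
    \int[P]_x (((EFin \o cst (1%R : R)) \+ (fun x => a%:E * (EFin \o f) x)) x +
               (fun x => b%:E * (EFin \o g) x) x))%E; last first.
  by apply: eq_integral => x _ /=; rewrite !EFinD !EFinM.
have Iaf := integrableZl measurableT a If; have Ibg := integrableZl measurableT b Ig.
rewrite integralD//; last exact: integrableD.
rewrite integralD// !integralZl// fF int1.
by rewrite EFinD EFinD EFinM leeD2l// EFinM lee_wpmul2l.
Qed.

(** The remainder of [expR_quad_le] is [s^2 X^4 exp (|s| X^2)]. One factor [exp (X^2 / 32)] absorbs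
    [X^4], another bounds the exponential since [|s| <= 1/32], and together they make the integrable
    [exp (X^2 / 16)]. *)
Lemma sqr_mgf_standard (X : T -> R) (q s : R) :
  measurable_fun setT X ->
  (forall t, \int[P]_x (expR (t * X x))%:E <= (expR (t ^+ 2 / 2))%:E)%E ->
  (\int[P]_x (X x ^+ 2)%:E = q%:E)%E -> `|s| <= 1 / 32 ->
  (\int[P]_x (expR (s * X x ^+ 2))%:E <= (expR (s * q + mgf_const * s ^+ 2))%:E)%E.
Proof.
move=> mX subg Xq s32.
have mX2 : measurable_fun setT (fun x => X x ^+ 2) by exact: measurable_funX.
have mE c : measurable_fun setT (fun x => expR (X x ^+ 2 * c)).
  by apply: measurable_expR_comp; exact: measurable_funM.
apply: (@le_trans _ _
    (\int[P]_x (1 + s * X x ^+ 2 + s ^+ 2 * 64 ^+ 2 * expR (X x ^+ 2 / 16))%:E)%E).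
  apply: ge0_le_integral => //.
  - by apply/measurable_EFinP; apply: measurable_expR_comp; exact: measurable_funM.
  - apply/measurable_EFinP; apply: measurable_funD; last exact: measurable_funM.
    by apply: measurable_funD => //; exact: measurable_funM.
  - move=> x _; rewrite lee_fin; apply: le_trans (expR_quad_le _) _.
    set z := X x ^+ 2; have z0 : 0 <= z by exact: sqr_ge0.
    rewrite lerD2l exprMn -[leLHS]mulrA -[leRHS]mulrA ler_wpM2l ?sqr_ge0//.
    have h1 : expR `|s * z| <= expR (z / 32).
      rewrite ler_expR normrM (ger0_norm z0) mulrC ler_wpM2l//; lra.
    have h2 : z ^+ 2 <= 64 ^+ 2 * expR (z / 32).
      have -> : expR (z / 32) = expR (z / 64) ^+ 2.
        by rewrite -expRM_natl; congr expR; field.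
      have h3 : z / 64 <= expR (z / 64) by have := expR_ge1Dx (z / 64); lra.
      have : (z / 64) ^+ 2 <= expR (z / 64) ^+ 2.
        by rewrite ler_pXn2r// nnegrE ?expR_ge0// divr_ge0.
      rewrite expr_div_n; lra.
    have -> : expR (z / 16) = expR (z / 32) * expR (z / 32).
      by rewrite -expRD; congr expR; field.
    apply: (@le_trans _ _ (64 ^+ 2 * expR (z / 32) * expR (z / 32))); last by rewrite mulrA.
    by rewrite ler_pM// ?sqr_ge0 ?expR_ge0.
apply: (@le_trans _ _ (1 + s * q + s ^+ 2 * 64 ^+ 2 * mixture_bound)%:E).
  apply: integral_affine => //.
  - by move=> x; exact: sqr_ge0.
  - by rewrite mulr_ge0// sqr_ge0.
  - exact: integral_expR_sqr_le.
rewrite lee_fin; apply: le_trans (expR_ge1Dx _); rewrite /mgf_const.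
by rewrite le_eqVlt; apply/orP; left; apply/eqP; ring.
Qed.

Lemma sqr_mgf (X : T -> R) (K q s : R) : 0 < K ->
  measurable_fun setT X ->
  (forall t, \int[P]_x (expR (t * X x))%:E <= (expR (K ^+ 2 * t ^+ 2 / 2))%:E)%E ->
  (\int[P]_x (X x ^+ 2)%:E = q%:E)%E -> `|s| <= 1 / (32 * K ^+ 2) ->
  (\int[P]_x (expR (s * X x ^+ 2))%:E <= (expR (s * q + mgf_const * K ^+ 4 * s ^+ 2))%:E)%E.
Proof.
move=> K0 mX subg Xq s32.
have Kn0 : K != 0 by rewrite gt_eqF.
have K2 : 0 < K ^+ 2 by rewrite exprn_gt0.
have := @sqr_mgf_standard (fun x => K^-1 * X x) (K^-1 ^+ 2 * q) (s * K ^+ 2).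
have mY : measurable_fun setT (fun x => K^-1 * X x) by exact: measurable_funM.
have sY t : (\int[P]_x (expR (t * (K^-1 * X x)))%:E <= (expR (t ^+ 2 / 2))%:E)%E.
  under eq_integral do rewrite mulrA.
  apply: le_trans (subg _) _.
  by rewrite (_ : K ^+ 2 * (t * K^-1) ^+ 2 / 2 = t ^+ 2 / 2)//; field.
have qY : (\int[P]_x ((K^-1 * X x) ^+ 2)%:E = (K^-1 ^+ 2 * q)%:E)%E.
  under eq_integral do rewrite exprMn EFinM.
  rewrite ge0_integralZl_EFin ?sqr_ge0 ?Xq//.
  - by move=> x _; rewrite lee_fin sqr_ge0.
  - by apply/measurable_EFinP; exact: measurable_funX.
have sK : `|s * K ^+ 2| <= 1 / 32.
  move: s32; rewrite invfM mulrA ler_pdivlMr// normrM (ger0_norm (ltW K2)).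
  by [].
move=> /(_ mY sY qY sK).
have -> : s * K ^+ 2 * (K^-1 ^+ 2 * q) + mgf_const * (s * K ^+ 2) ^+ 2 =
   s * q + mgf_const * K ^+ 4 * s ^+ 2 by field.
apply: le_trans; rewrite le_eqVlt; apply/orP; left; apply/eqP.
by apply: eq_integral => x _; congr (expR _)%:E; field.
Qed.

End SquareMgf.

(** * Concentration *)

Section Concentration.
Context {R : realType} d (T : measurableType d) (P : probability T R).
Context d' (T' : measurableType d') (n : nat) (V : 'I_n -> T -> T') (h : T' -> R).
Variables (K : R) (q : 'I_n -> R).
Hypothesis K0 : 0 < K.
Hypothesis mV : forall i, measurable_fun setT (V i).
Hypothesis indep : independent_family P V.
Hypothesis mh : measurable_fun setT h.
Hypothesis subg : forall i t,
  (\int[P]_x (expR (t * h (V i x)))%:E <= (expR (K ^+ 2 * t ^+ 2 / 2))%:E)%E.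
Hypothesis second : forall i, (\int[P]_x (h (V i x) ^+ 2)%:E = (q i)%:E)%E.

Let A : R := mgf_const * K ^+ 4.

Lemma measurable_sum_sqr :
  measurable_fun setT (fun x => \sum_i (h (V i x) ^+ 2 - q i)).
Proof.
apply: measurable_sum => i; apply: measurable_funB => //.
by apply: measurable_funX; exact: measurableT_comp.
Qed.

Lemma measurable_mean_sqr :
  measurable_fun setT (fun x => n%:R^-1 * \sum_i (h (V i x) ^+ 2 - q i)).
Proof. by apply: measurable_funM => //; exact: measurable_sum_sqr. Qed.

(** Markov's inequality for the exponential, factorized by independence; the sign of [s] selects the
    tail. *)
Lemma chernoff_sum_sqr (s t : R) : `|s| <= 1 / (32 * K ^+ 2) ->
  (P [set x | `|s| * (n%:R * t) <= s * (\sum_i (h (V i x) ^+ 2 - q i))]%R <=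
    (expR (n%:R * (A * s ^+ 2 - `|s| * t)))%:E)%E.
Proof.
move=> s32; set D := [set x | _].
have mS := measurable_sum_sqr.
have mD : measurable D.
  rewrite -[D]setTI; apply: measurable_fun_le => //.
  exact: measurable_funM.
pose f (i : 'I_n) y := expR (s * h y ^+ 2).
have mf i : measurable_fun setT (f i).
  by apply: measurable_expR_comp; apply: measurable_funM => //; exact: measurable_funX.
pose B i := expR (s * q i + A * s ^+ 2).
have fB i : (\int[P]_x (f i (V i x))%:E <= (B i)%:E)%E.
  apply: (@sqr_mgf _ _ _ _ (fun x => h (V i x)) K (q i) s K0) => //.
  exact: measurableT_comp.
pose e i := fine (\int[P]_x (f i (V i x))%:E).
have f0 i y : 0 <= f i y by exact: expR_ge0.
have ef i : (\int[P]_x (f i (V i x))%:E = (e i)%:E)%E.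
  rewrite /e fineK// ge0_fin_numE; first exact: le_lt_trans (fB i) (ltry _).
  by apply: integral_ge0 => x _; rewrite lee_fin.
have e0 i : 0 <= e i by rewrite fine_ge0// integral_ge0// => x _; rewrite lee_fin.
have prodE := integral_prod_independent mV indep mf f0 ef.
pose c := expR (- (s * (\sum_i q i) + `|s| * (n%:R * t))).
have mprod : measurable_fun setT (fun x => \prod_i f i (V i x)).
  by apply: measurable_prod_fun => i; exact: measurableT_comp.
apply: (@le_trans _ _ (\int[P]_x (c * \prod_i f i (V i x))%:E)%E).
  rewrite -integral_indicT//; apply: ge0_le_integral => //.
  - by apply/measurable_EFinP; exact: measurable_indic.
  - by apply/measurable_EFinP; exact: measurable_funM.
  - move=> x _; rewrite lee_fin indicE; case: (boolP (x \in D)) => [|_]; last first.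
      by rewrite mulr_ge0 ?expR_ge0// prodr_ge0.
    rewrite inE /D /= => Dx; rewrite /f -expR_sum -mulr_sumr -expRD.
    rewrite sumrB in Dx; rewrite -[leLHS]expR0 ler_expR; lra.
under eq_integral do rewrite EFinM.
rewrite ge0_integralZl_EFin ?expR_ge0//; last 2 first.
- by move=> x _; rewrite lee_fin prodr_ge0.
- exact/measurable_EFinP.
rewrite prodE -EFinM lee_fin.
have prodB : \prod_i e i <= expR (s * (\sum_i q i) + n%:R * (A * s ^+ 2)).
  have -> : s * (\sum_i q i) + n%:R * (A * s ^+ 2) = \sum_i (s * q i + A * s ^+ 2).
    by rewrite big_split -mulr_sumr sumr_const card_ord mulr_natl.
  rewrite expR_sum; apply: ler_prod => i _; rewrite e0 /=.
  by rewrite -lee_fin -ef.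
apply: (@le_trans _ _ (c * expR (s * (\sum_i q i) + n%:R * (A * s ^+ 2)))).
  by rewrite ler_wpM2l ?expR_ge0.
by rewrite -expRD ler_expR le_eqVlt; apply/orP; left; apply/eqP; ring.
Qed.

Lemma mean_sqr_concentration (t : R) : (0 < n)%N ->
  0 < t -> t <= mgf_const * K ^+ 2 / 16 ->
  (P [set x | t <= `|n%:R^-1 * (\sum_i (h (V i x) ^+ 2 - q i))| ]%R <=
    (2 * expR (- (n%:R * t ^+ 2 / (4 * A))))%:E)%E.
Proof.
move=> n0 t0 tK.
have n0R : 0 < n%:R :> R by rewrite ltr0n.
have A0 : 0 < A by rewrite mulr_gt0 ?mgf_const_gt0// exprn_gt0.
(* The minimizer of [A s^2 - s t]; the upper bound on [t] says exactly that
   [|s| <= 1 / (32 K^2)]. *)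
pose s := t / (2 * A).
have s0 : 0 < s by rewrite divr_gt0// mulr_gt0.
have s32 : `|s| <= 1 / (32 * K ^+ 2).
  rewrite gtr0_norm// ler_pdivrMr ?mulr_gt0//; apply: le_trans tK _.
  rewrite le_eqVlt; apply/orP; left; apply/eqP; rewrite /A; field.
  by rewrite gt_eqF.
have expE : n%:R * (A * s ^+ 2 - `|s| * t) = - (n%:R * t ^+ 2 / (4 * A)).
  by rewrite gtr0_norm// /s; field; rewrite gt_eqF.
have h1 := chernoff_sum_sqr t s32; rewrite expE in h1.
have h2 := @chernoff_sum_sqr (- s) t; rewrite normrN sqrrN expE in h2.
have {}h2 := h2 s32.
set D1 := (X in (P X <= _)%E) in h1; set D2 := (X in (P X <= _)%E) in h2.
have mS := measurable_sum_sqr.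
have mD u : measurable [set x | `|s| * (n%:R * t) <= u * (\sum_i (h (V i x) ^+ 2 - q i))]%R.
  rewrite -[X in measurable X]setTI; apply: measurable_fun_le => //.
  exact: measurable_funM.
rewrite mulr2n mulrDl mul1r EFinD; apply: le_trans (leeD h1 h2).
apply: le_trans (measureU2 _ _ _); [|exact: mD..].
apply: le_measure; rewrite ?inE.
- rewrite -[X in measurable X]setTI; apply: measurable_fun_le => //.
  by apply: measurableT_comp => //; exact: measurable_mean_sqr.
- by apply: measurableU; exact: mD.
move=> x; rewrite /D1 /D2 /setU /= (gtr0_norm s0).
set S := \sum_i _ => Sx.
have -> : S = n%:R * (n%:R^-1 * S) by rewrite mulVKf// gt_eqF.
move: Sx; set z := _ * S; rewrite ler_normr => /orP[zt|zt]; [left|right] => /=.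
  by rewrite ler_pM2l// ler_pM2l.
by rewrite mulNr -mulrN ler_pM2l// -mulrN ler_pM2l.
Qed.

End Concentration.

(** * Second moments *)

Section Moments.
Context {R : realType} d (T : measurableType d) (P : probability T R).
Implicit Types (f g : T -> R) (e c : R).

(** Integrability and a real value are carried together, so that moments add and scale without
    finiteness side conditions. *)
Definition has_mean f e :=
  P.-integrable setT (EFin \o f) /\ (\int[P]_x (f x)%:E = e%:E)%E.

Lemma has_mean_ext f g e : (forall x, f x = g x) -> has_mean f e -> has_mean g e.
Proof. by move=> /funext ->. Qed.

Lemma has_meanD f g e e' : has_mean f e -> has_mean g e' ->
  has_mean (fun x => f x + g x) (e + e').
Proof.
move=> [If Ef] [Ig Eg]; split; first exact: (integrableD measurableT If Ig).
under eq_integral do rewrite EFinD.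
by rewrite (integralD measurableT If Ig) /= Ef Eg.
Qed.

Lemma has_meanZ c f e : has_mean f e -> has_mean (fun x => c * f x) (c * e).
Proof.
move=> [If Ef]; split; first exact: (integrableZl measurableT c If).
under eq_integral do rewrite EFinM.
by rewrite (integralZl measurableT If) /= Ef.
Qed.

Lemma has_meanB f g e e' : has_mean f e -> has_mean g e' ->
  has_mean (fun x => f x - g x) (e - e').
Proof.
move=> hf /(has_meanZ (-1)) hg; have := has_meanD hf hg.
by rewrite mulN1r; apply: has_mean_ext => x; rewrite mulN1r.
Qed.

Lemma has_mean_ge0 f e : measurable_fun setT f -> (forall x, 0 <= f x) ->
  (\int[P]_x (f x)%:E = e%:E)%E -> has_mean f e.
Proof.
move=> mf f0 fe; split => //.
by apply: (@ge0_integral_fin_integrable _ _ _ _ _ e) => //; rewrite fe.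
Qed.

Lemma has_mean0 : has_mean (fun=> 0) 0.
Proof. by apply: has_mean_ge0 => //; rewrite integral0. Qed.

Lemma has_mean1 : has_mean (fun=> 1) 1.
Proof.
apply: has_mean_ge0 => //.
transitivity (1 * P setT)%E; first exact: (integral_cst P measurableT 1).
by rewrite mul1e; exact: probability_setT.
Qed.

Lemma has_mean_sum (I : Type) (r : seq I) (F : I -> T -> R) (E : I -> R) :
  (forall i, has_mean (F i) (E i)) ->
  has_mean (fun x => \sum_(i <- r) F i x) (\sum_(i <- r) E i).
Proof.
move=> FE; elim: r => [|i r IH].
  by rewrite big_nil; apply: has_mean_ext has_mean0 => x; rewrite big_nil.
by rewrite big_cons; apply: has_mean_ext (has_meanD (FE i) IH) => x; rewrite big_cons.
Qed.

Lemma has_mean_uniq f e e' : has_mean f e -> has_mean f e' -> e = e'.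
Proof. by move=> [_ Ef] [_]; rewrite Ef => -[]. Qed.

Lemma has_mean_measurable f e : has_mean f e -> measurable_fun setT f.
Proof. by move=> [/measurable_int /measurable_EFinP]. Qed.

Lemma has_mean_dominated f g e : measurable_fun setT f ->
  (forall x, `|f x| <= g x) -> has_mean g e -> exists e', has_mean f e'.
Proof.
move=> mf fg [Ig Eg].
have If : P.-integrable setT (EFin \o f).
  apply: (le_integrable measurableT _ _ Ig); first exact/measurable_EFinP.
  move=> x _ /=; rewrite lee_fin (le_trans (fg x))//; exact: ler_norm.
exists (fine (\int[P]_x (f x)%:E)); split => //.
by rewrite fineK// integrable_fin_num.
Qed.

Definition square_integrable f :=
  measurable_fun setT f /\ exists e, has_mean (fun x => f x ^+ 2) e.

Lemma square_integrable_mul f g : square_integrable f -> square_integrable g ->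
  exists e, has_mean (fun x => f x * g x) e.
Proof.
move=> [mf [e Ef]] [mg [e' Eg]].
apply: has_mean_dominated (has_meanD Ef Eg); first exact: measurable_funM.
move=> x; rewrite normrM -[f x ^+ 2]real_normK ?num_real// -[g x ^+ 2]real_normK ?num_real//.
have := sqr_ge0 (`|f x| - `|g x|); have := mulr_ge0 (normr_ge0 (f x)) (normr_ge0 (g x)); nra.
Qed.

Lemma square_integrable_mean f : square_integrable f -> exists e, has_mean f e.
Proof.
move=> sf; have s1 : square_integrable (fun=> 1).
  split => //; exists 1; apply: has_mean_ext has_mean1 => x; by rewrite expr1n.
have [e h] := square_integrable_mul sf s1; exists e.
by apply: has_mean_ext h => x; rewrite mulr1.
Qed.

Lemma has_mean_le f g e e' : has_mean f e -> has_mean g e' ->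
  (forall x, f x <= g x) -> e <= e'.
Proof.
move=> hf hg fg; have [_ h] := has_meanB hg hf.
rewrite -subr_ge0 -lee_fin -h; apply: integral_ge0 => x _.
by rewrite lee_fin subr_ge0.
Qed.

Lemma sqr_le_expR (x : R) : x ^+ 2 <= 4 * (expR x + expR (- x)).
Proof.
have h3 : expR `|x| <= expR x + expR (- x).
  have [x0|x0] := leP 0 x; first by rewrite ger0_norm// lerDl expR_ge0.
  by rewrite ltr0_norm// lerDr expR_ge0.
have h4 : `|x| / 2 <= expR (`|x| / 2) by have := expR_ge1Dx (`|x| / 2); lra.
have h5 : (`|x| / 2) ^+ 2 <= expR `|x|.
  have -> : expR `|x| = expR (`|x| / 2) ^+ 2.
    by rewrite -expRM_natl; congr expR; field.
  by rewrite ler_pXn2r// nnegrE ?expR_ge0// divr_ge0.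
rewrite expr_div_n real_normK ?num_real// in h5; lra.
Qed.

Section SecondMoment.
Variables (f : T -> R) (M : R).
Hypothesis mf : measurable_fun setT f.
Hypothesis mgf : forall t,
  (\int[P]_x (expR (t * f x))%:E <= (expR (M * t ^+ 2))%:E)%E.

Lemma has_mean_expR t :
  exists2 e, has_mean (fun x => expR (t * f x)) e & e <= expR (M * t ^+ 2).
Proof.
have mE : measurable_fun setT (fun x => expR (t * f x)).
  by apply: measurable_expR_comp; exact: measurable_funM.
have fin : (\int[P]_x (expR (t * f x))%:E)%E \is a fin_num.
  rewrite ge0_fin_numE; first exact: le_lt_trans (mgf t) (ltry _).
  by apply: integral_ge0 => x _; rewrite lee_fin expR_ge0.
exists (fine (\int[P]_x (expR (t * f x))%:E)).
  by apply: has_mean_ge0 => //; rewrite fineK.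
by rewrite -lee_fin fineK.
Qed.

(** [x^2 <= 4 (exp x + exp (- x))], with the hypothesis at [t = 1] and [t = -1]. *)
Lemma square_integrable_of_mgf :
  square_integrable f /\ forall q, has_mean (fun x => f x ^+ 2) q -> q <= 8 * expR M.
Proof.
have [e1 h1 l1] := has_mean_expR 1; have [e2 h2 l2] := has_mean_expR (-1).
rewrite sqrrN expr1n mulr1 in l1 l2.
have h := has_meanZ 4 (has_meanD h1 h2).
have le x : f x ^+ 2 <= 4 * (expR (1 * f x) + expR (-1 * f x)).
  by rewrite mul1r mulN1r sqr_le_expR.
split; last by move=> q hq; have := has_mean_le hq h le; lra.
split => //; apply: has_mean_dominated h; first exact: measurable_funX.
by move=> x; rewrite ger0_norm ?sqr_ge0.
Qed.

End SecondMoment.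

Lemma has_mean_parts f e : has_mean f e ->
  exists a b, [/\ has_mean (fun x => Num.max (f x) 0) a,
                  has_mean (fun x => Num.max (- f x) 0) b & e = a - b].
Proof.
move=> h; have mf := has_mean_measurable h.
have [e' h'] : exists e', has_mean (fun x => `|f x|) e'.
  have [If Ef] := h.
  have If' : P.-integrable setT (EFin \o (fun x => `|f x|)).
    by have := integrable_norm If; apply.
  exists (fine (\int[P]_x `|f x|%:E)); split => //.
  by rewrite fineK// integrable_fin_num.
have [a ha] : exists a, has_mean (fun x => Num.max (f x) 0) a.
  apply: (has_mean_dominated _ _ h').
    by apply: measurable_maxr.
  by move=> x; have [x0|x0] := leP (f x) 0; rewrite ?normr0.
have [b hb] : exists b, has_mean (fun x => Num.max (- f x) 0) b.
  apply: (has_mean_dominated _ _ h').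
    by apply: measurable_maxr => //; exact: measurableT_comp.
  by move=> x; have [x0|x0] := leP (- f x) 0; rewrite ?normr0// normrN.
exists a, b; split => //; apply: has_mean_uniq h _.
apply: has_mean_ext (has_meanB ha hb) => x.
by have [x0|x0] := leP (f x) 0; have [x1|x1] := leP (- f x) 0; lra.
Qed.

(** Splits [f] into positive and negative parts; product formulas for nonnegative factors thus
    extend to signed ones, one factor at a time. *)
Lemma has_mean_mul_signed d' (T' : measurableType d') (X : T -> T') (G : T -> R) c :
  (forall (f : T' -> R) e, measurable_fun setT f -> (forall y, 0 <= f y) ->
     has_mean (f \o X) e -> has_mean (fun x => G x * f (X x)) (c * e)) ->
  forall (f : T' -> R) e, measurable_fun setT f ->
     has_mean (f \o X) e -> has_mean (fun x => G x * f (X x)) (c * e).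
Proof.
move=> H f e mf /has_mean_parts[a [b [ha hb ->]]].
have hp := H (fun y => Num.max (f y) 0) a.
have hn := H (fun y => Num.max (- f y) 0) b.
rewrite mulrBr; apply: has_mean_ext (has_meanB (hp _ _ ha) (hn _ _ hb)).
- move=> x; rewrite -mulrBr; congr (_ * _).
  by have [x0|x0] := leP (f (X x)) 0; have [x1|x1] := leP (- f (X x)) 0; lra.
- exact: measurable_maxr.
- by move=> y; rewrite le_max lexx orbT.
- by apply: measurable_maxr => //; exact: measurableT_comp.
- by move=> y; rewrite le_max lexx orbT.
Qed.

Lemma has_mean_mul_independent3 d1 d2 d3 (T1 : measurableType d1)
    (T2 : measurableType d2) (T3 : measurableType d3)
    (X1 : T -> T1) (X2 : T -> T2) (X3 : T -> T3)
    (f1 : T1 -> R) (f2 : T2 -> R) (f3 : T3 -> R) (e1 e2 e3 : R) :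
  measurable_fun setT X1 -> measurable_fun setT X2 -> measurable_fun setT X3 ->
  independent3 P X1 X2 X3 ->
  measurable_fun setT f1 -> measurable_fun setT f2 -> measurable_fun setT f3 ->
  has_mean (f1 \o X1) e1 -> has_mean (f2 \o X2) e2 -> has_mean (f3 \o X3) e3 ->
  has_mean (fun x => f1 (X1 x) * f2 (X2 x) * f3 (X3 x)) (e1 * e2 * e3).
Proof.
move=> mX1 mX2 mX3 indep mf1 mf2 mf3 h1 h2 h3.
apply: (has_mean_mul_signed _ mf3 h3) => {}f3 {}e3 {}mf3 f30 {}h3.
apply: has_mean_ext (_ : has_mean (fun x => f1 (X1 x) * f3 (X3 x) * f2 (X2 x)) (e1 * e2 * e3)).
  by move=> x; rewrite mulrAC.
rewrite mulrAC.
apply: (has_mean_mul_signed _ mf2 h2) => {}f2 {}e2 {}mf2 f20 {}h2.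
apply: has_mean_ext (_ : has_mean (fun x => f2 (X2 x) * f3 (X3 x) * f1 (X1 x)) (e1 * e3 * e2)).
  by move=> x; ring.
have -> : e1 * e3 * e2 = e2 * e3 * e1 by ring.
apply: (has_mean_mul_signed _ mf1 h1) => {}f1 {}e1 {}mf1 f10 {}h1.
apply: has_mean_ge0.
- by apply: measurable_funM; [apply: measurable_funM|]; exact: measurableT_comp.
- by move=> x; rewrite !mulr_ge0.
have -> : e2 * e3 * e1 = e1 * e2 * e3 by ring.
rewrite -(integral_mul_independent3 mX1 mX2 mX3 indep mf1 mf2 mf3 f10 f20 f30 h1.2 h2.2 h3.2).
by apply: eq_integral => x _; congr EFin; ring.
Qed.

End Moments.

Section LinearForms.
Context {R : realType} d (T : measurableType d) (P : probability T R) {p : nat}.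

Definition linform (a : 'cV[R]_p) (v : p.-tuple R) : R := \sum_j a j 0 * tnth v j.

Lemma measurable_linform a : measurable_fun setT (linform a).
Proof.
apply: measurable_sum => j; apply: measurable_funM => //.
exact: measurable_tnth.
Qed.

Lemma linform_delta j v : linform (delta_mx j 0) v = tnth v j.
Proof.
rewrite /linform (bigD1 j)//= mxE !eqxx mul1r big1 ?addr0// => i ij.
by rewrite mxE (negPf ij) mul0r.
Qed.

Lemma mmt_gen_funE (X : T -> R) t : mmt_gen_fun P X t = (\int[P]_x (expR (t * X x))%:E)%E.
Proof.
rewrite /mmt_gen_fun unlock; apply: eq_integral => x _ /=.
by rewrite mulrC.
Qed.

Lemma linform_mgf (sig : R) (X : T -> p.-tuple R) (a : 'cV[R]_p) t :
  centred_subgaussian_vector P sig X ->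
  (\int[P]_x (expR (t * linform a (X x)))%:E <=
    (expR ((sig * l2norm a) ^+ 2 * t ^+ 2 / 2))%:E)%E.
Proof.
move=> [_ H]; have [->|a0] := eqVneq a 0.
  have -> : l2norm (0 : 'cV[R]_p) = 0.
    by apply/eqP; rewrite -sqrf_eq0 l2norm_dotp dotp0l.
  rewrite mulr0 expr0n/= !mul0r expR0.
  under eq_integral => x _.
    rewrite /linform big1 ?mulr0 ?expR0 => [|j _]; last by rewrite mxE mul0r.
    over.
  by have [_ ->] := has_mean1 P.
have l0 : l2norm a != 0 by apply: contra_neq a0; exact: l2norm_eq0.
have u1 : l2norm ((l2norm a)^-1 *: a) = 1.
  by rewrite l2normZ ger0_norm ?invr_ge0 ?l2norm_ge0// mulVf.
have := H _ u1 (t * l2norm a); rewrite mmt_gen_funE.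
have -> : sig ^+ 2 * (t * l2norm a) ^+ 2 / 2 = (sig * l2norm a) ^+ 2 * t ^+ 2 / 2 by ring.
apply: le_trans; rewrite le_eqVlt; apply/orP; left; apply/eqP.
apply: eq_integral => x _; congr (expR _)%:E.
rewrite -mulrA; congr (t * _); rewrite mulr_sumr; apply: eq_bigr => j _.
by rewrite mxE -mulrA mulVKf.
Qed.

Section OneSample.
Variables (X W : T -> p.-tuple R) (eps : T -> R).
Variables (sigx sigw sige : R) (Sx Sw : 'M[R]_p).
Hypothesis mX : measurable_fun setT X.
Hypothesis mW : measurable_fun setT W.
Hypothesis meps : measurable_fun setT eps.
Hypothesis indep : independent3 P X W eps.
Hypothesis sgX : centred_subgaussian_vector P sigx X.
Hypothesis sgW : centred_subgaussian_vector P sigw W.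
Hypothesis sgeps : centred_subgaussian P sige eps.
Hypothesis covX : cov_matrix P X Sx.
Hypothesis covW : cov_matrix P W Sw.

(** [a = b = u], [c = 0] gives [z^T u]. For the noise, [a = e_j] with [b = e_j + bstar], [c = -1]
    and with [b = e_j - bstar], [c = 1] are the two forms used in the polarization. *)
Definition sample_form (a b : 'cV[R]_p) (c : R) (v : p.-tuple R * p.-tuple R * R) : R :=
  linform a v.1.1 + linform b v.1.2 + c * v.2.

Lemma measurable_sample_form a b c : measurable_fun setT (sample_form a b c).
Proof.
apply: measurable_funD; last exact: measurable_funM.
apply: measurable_funD; apply: measurableT_comp; try exact: measurable_linform.
  by apply: measurableT_comp => //; exact: measurable_fst.
by apply: measurableT_comp => //; exact: measurable_fst.
Qed.

Lemma mgf_fin (Y : T -> R) (M t : R) : measurable_fun setT Y ->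
  (\int[P]_x (expR (t * Y x))%:E <= M%:E)%E ->
  exists e, (\int[P]_x (expR (t * Y x))%:E = e%:E)%E /\ 0 <= e <= M.
Proof.
move=> mY YM; exists (fine (\int[P]_x (expR (t * Y x))%:E)).
have h0 : (0 <= \int[P]_x (expR (t * Y x))%:E)%E.
  by apply: integral_ge0 => x _; rewrite lee_fin expR_ge0.
have hf : (\int[P]_x (expR (t * Y x))%:E)%E \is a fin_num.
  by rewrite ge0_fin_numE//; exact: le_lt_trans YM (ltry _).
by rewrite fineK//; split => //; rewrite fine_ge0//= -lee_fin fineK.
Qed.

Lemma eps_mgf t : (\int[P]_x (expR (t * eps x))%:E <= (expR (sige ^+ 2 * t ^+ 2 / 2))%:E)%E.
Proof. by have [_ /(_ t)] := sgeps; rewrite mmt_gen_funE. Qed.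

(** By independence the exponential moments multiply, so the sub-Gaussian parameters add in
    squares. *)
Lemma sample_form_mgf a b c (K t : R) :
  (sigx * l2norm a) ^+ 2 + (sigw * l2norm b) ^+ 2 + (sige * c) ^+ 2 <= K ^+ 2 ->
  (\int[P]_x (expR (t * sample_form a b c (X x, W x, eps x)))%:E <=
    (expR (K ^+ 2 * t ^+ 2 / 2))%:E)%E.
Proof.
move=> HK.
have m1 : measurable_fun setT (fun x => linform a (X x)).
  by apply: measurableT_comp mX => //; exact: measurable_linform.
have m2 : measurable_fun setT (fun x => linform b (W x)).
  by apply: measurableT_comp mW => //; exact: measurable_linform.
have [e1 [E1 /andP[e10 e1M]]] := mgf_fin m1 (linform_mgf a t sgX).
have [e2 [E2 /andP[e20 e2M]]] := mgf_fin m2 (linform_mgf b t sgW).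
have [e3 [E3 /andP[e30 e3M]]] := mgf_fin meps (eps_mgf (t * c)).
have mE (a' : 'cV[R]_p) : measurable_fun setT (fun v => expR (t * linform a' v)).
  by apply: measurable_expR_comp; apply: measurable_funM => //; exact: measurable_linform.
have := integral_mul_independent3 mX mW meps indep (mE a) (mE b)
  (_ : measurable_fun setT (fun v : R => expR (t * c * v))) _ _ _ E1 E2 E3.
have me : measurable_fun setT (fun v : R => expR (t * c * v)).
  by apply: measurable_expR_comp; exact: measurable_funM.
move=> /(_ me (fun y => expR_ge0 _) (fun y => expR_ge0 _) (fun y => expR_ge0 _)) H.
have -> : (\int[P]_x (expR (t * sample_form a b c (X x, W x, eps x)))%:E
    = (e1 * e2 * e3)%:E)%E.
  rewrite -H; apply: eq_integral => x _; rewrite -!expRD /sample_form /=.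
  by congr (expR _)%:E; ring.
rewrite lee_fin; apply: (@le_trans _ _ (expR ((sigx * l2norm a) ^+ 2 * t ^+ 2 / 2) *
  expR ((sigw * l2norm b) ^+ 2 * t ^+ 2 / 2) * expR (sige ^+ 2 * (t * c) ^+ 2 / 2))).
  by apply: ler_pM => //; [exact: mulr_ge0 | exact: ler_pM].
rewrite -!expRD ler_expR.
have := ler_wpM2r (sqr_ge0 t) HK; rewrite !exprMn; lra.
Qed.

Lemma linform_square_integrable (Y : T -> p.-tuple R) sig a :
  measurable_fun setT Y -> centred_subgaussian_vector P sig Y ->
  square_integrable P (linform a \o Y) /\
  forall q, has_mean P (fun x => linform a (Y x) ^+ 2) q ->
    q <= 8 * expR ((sig * l2norm a) ^+ 2 / 2).
Proof.
move=> mY sgY; apply: (@square_integrable_of_mgf _ _ _ _ (linform a \o Y)).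
  by apply: measurableT_comp mY => //; exact: measurable_linform.
move=> t; apply: le_trans (linform_mgf a t sgY) _.
by rewrite lee_fin ler_expR mulrAC.
Qed.

Lemma linform_second (Y : T -> p.-tuple R) sig (S : 'M[R]_p) a :
  measurable_fun setT Y -> centred_subgaussian_vector P sig Y ->
  cov_matrix P Y S ->
  has_mean P (fun x => linform a (Y x) ^+ 2) (dotp a (S *m a)).
Proof.
move=> mY sgY covY.
have co j : square_integrable P (coord Y j).
  have [+ _] := linform_square_integrable (delta_mx j 0) mY sgY.
  by congr (square_integrable P _); apply/funext => x /=; rewrite linform_delta.
have hS i j : has_mean P (fun x => coord Y i x * coord Y j x) (S i j).
  have [e he] := square_integrable_mul (co i) (co j).
  suff -> : S i j = e by [].
  have := covY i j; rewrite unlock.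
  have [E0 _] := sgY; rewrite !E0 /= unlock => H.
  have [_ Ee] := he; apply: EFin_inj; rewrite -H -Ee.
  apply: eq_integral => x _; congr EFin.
  by rewrite [LHS]/((coord Y i x - 0) * (coord Y j x - 0)) !subr0.
rewrite dotp_quadE.
have := has_mean_sum (index_enum _) (fun i => has_mean_sum (index_enum _)
   (fun j => has_meanZ (a i 0 * a j 0) (hS i j))).
have -> : \sum_i \sum_j a i 0 * a j 0 * S i j = \sum_i \sum_j S i j * a i 0 * a j 0.
  by apply: eq_bigr => i _; apply: eq_bigr => j _; ring.
apply: has_mean_ext => x; rewrite expr2 /linform mulr_suml.
apply: eq_bigr => i _; rewrite mulr_sumr; apply: eq_bigr => j _.
by rewrite /coord; ring.
Qed.

Lemma cov_matrix_diag_le (Y : T -> p.-tuple R) sig (S : 'M[R]_p) j :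
  measurable_fun setT Y -> centred_subgaussian_vector P sig Y ->
  cov_matrix P Y S -> S j j <= 8 * expR (sig ^+ 2 / 2).
Proof.
move=> mY sgY covY.
have [_ /(_ _ (linform_second (delta_mx j 0) mY sgY covY))] :=
  linform_square_integrable (delta_mx j 0) mY sgY.
by rewrite l2norm_delta mulr1 dotpC dotp_delta -colE mxE.
Qed.

Lemma linform_mean (Y : T -> p.-tuple R) sig a :
  measurable_fun setT Y -> centred_subgaussian_vector P sig Y ->
  has_mean P (linform a \o Y) 0.
Proof.
move=> mY sgY.
have co j : has_mean P (coord Y j) 0.
  have [+ _] := linform_square_integrable (delta_mx j 0) mY sgY.
  move=> /square_integrable_mean[e he].
  have {}he : has_mean P (coord Y j) e.
    by apply: has_mean_ext he => x /=; rewrite linform_delta.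
  suff <- : e = 0 by [].
  have [+ _] := sgY => /(_ j); have [_ Ee] := he.
  by rewrite unlock Ee => -[].
have := has_mean_sum (index_enum _) (fun j => has_meanZ (a j 0) (co j)).
by rewrite big1 => [|j _]; [apply: has_mean_ext | rewrite mulr0].
Qed.

(** Cross terms vanish by independence and centring. The noise variance [v] is quantified before the
    coefficients, so that it cancels between two forms with the same [c ^+ 2]. *)
Lemma sample_form_second : exists v : R, forall a b c,
  has_mean P (fun x => sample_form a b c (X x, W x, eps x) ^+ 2)
    (dotp a (Sx *m a) + dotp b (Sw *m b) + c ^+ 2 * v).
Proof.
have seps : square_integrable P eps.
  apply: (proj1 (@square_integrable_of_mgf _ _ _ _ _ (sige ^+ 2 / 2) _ _)) => // t.
  by apply: le_trans (eps_mgf t) _; rewrite lee_fin ler_expR mulrAC.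
have [_ [v hv]] := seps; exists v => a b c.
have he : has_mean P eps 0.
  have [e he] := square_integrable_mean seps.
  suff <- : e = 0 by [].
  have [+ _] := sgeps; have [_ Ee] := he.
  by rewrite unlock Ee => -[].
have hA := linform_mean a mX sgX; have hB := linform_mean b mW sgW.
have mla := measurable_linform a; have mlb := measurable_linform b.
have mid : measurable_fun setT (fun y : R => y) by exact: measurable_id.
have mc1 d' (T' : measurableType d') : measurable_fun setT (fun _ : T' => 1 : R) by [].
have AB := has_mean_mul_independent3 mX mW meps indep mla mlb (mc1 _ _) hA hB (has_mean1 P).
have AC := has_mean_mul_independent3 mX mW meps indep mla (mc1 _ _) mid hA (has_mean1 P) he.
have BC := has_mean_mul_independent3 mX mW meps indep (mc1 _ _) mlb mid (has_mean1 P) hB he.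
have A2 := linform_second a mX sgX covX; have B2 := linform_second b mW sgW covW.
have := has_meanD (has_meanD (has_meanD A2 B2) (has_meanZ (c ^+ 2) hv))
  (has_meanD (has_meanZ 2 AB) (has_meanD (has_meanZ (2 * c) AC) (has_meanZ (2 * c) BC))).
rewrite !(mul0r, mulr0, addr0); apply: has_mean_ext => x.
by rewrite /sample_form /=; ring.
Qed.

End OneSample.
End LinearForms.

(** * Deviation of the surrogate estimators *)

Section Estimators.
Context {R : realType} {n p : nat}.
Implicit Types (Z : 'M[R]_(n, p)) (S : 'M[R]_p).

Lemma Gamma_hat_sym Z S : S^T = S -> (Gamma_hat Z S)^T = Gamma_hat Z S.
Proof. by move=> ST; rewrite /Gamma_hat linearB linearZ /= trmx_mul trmxK ST. Qed.

Lemma Gamma_hat_quad Z S (u : 'cV[R]_p) :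
  dotp u (Gamma_hat Z S *m u) =
  n%:R^-1 * (\sum_i (Z *m u) i 0 ^+ 2) - dotp u (S *m u).
Proof.
rewrite /Gamma_hat mulmxBl -scalemxAl dotpDr dotpNr dotpZr -mulmxA.
by rewrite [dotp u (Z^T *m _)]dotp_mulmx trmxK dotpE.
Qed.

Lemma Gamma_hat_residual Z S (b : 'cV[R]_p) (y : 'cV[R]_n) j :
  (Gamma_hat Z S *m b - gamma_hat Z y) j 0 =
  n%:R^-1 * (\sum_i Z i j * (Z *m b - y) i 0) - (S *m b) j 0.
Proof.
have -> : Gamma_hat Z S *m b - gamma_hat Z y = n%:R^-1 *: (Z^T *m (Z *m b - y)) - S *m b.
  by rewrite /Gamma_hat /gamma_hat mulmxBl -scalemxAl mulmxBr scalerBr -mulmxA addrAC.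
have subE (A B : 'cV[R]_p) : (A - B) j 0 = A j 0 - B j 0 by rewrite !mxE.
have scaleE (c : R) (A : 'cV[R]_p) : (c *: A) j 0 = c * A j 0 by rewrite mxE.
rewrite subE scaleE; congr (_ * _ - _).
by rewrite [LHS]mxE; apply: eq_bigr => i _; rewrite mxE.
Qed.

End Estimators.

Section UnionBound.
Context {R : realType} d (T : measurableType d) (P : probability T R).

Lemma union_bound (I : finType) (F : I -> set T) (c : R) :
  (forall i, measurable (F i)) -> (forall i, (P (F i) <= c%:E)%E) ->
  measurable (\big[setU/set0]_i F i) /\
  (P (\big[setU/set0]_i F i) <= (#|I|%:R * c)%:E)%E.
Proof.
move=> mF Fc; split; first exact: bigsetU_measurable.
have -> : #|I|%:R * c = \sum_(i : I) c by rewrite sumr_const mulr_natl.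
elim: (index_enum I) => [|i r IH]; first by rewrite !big_nil measure0.
rewrite !big_cons EFinD; apply: le_trans (leeD (Fc i) IH).
by apply: measureU2 => //; exact: bigsetU_measurable.
Qed.

End UnionBound.

Section Deviation.
Context {R : realType} d (T : measurableType d) (P : probability T R) {n p : nat}.
Variables (sigx sigw sige : R).
Variables (x w : 'I_n -> {RV P >-> p.-tuple R}) (eps : 'I_n -> {RV P >-> R}).
Variables (Sx Sw : 'M[R]_p).
Hypothesis model : subgaussian_model sigx sigw sige x w eps.
Hypothesis covx : forall i, cov_matrix P (x i) Sx.
Hypothesis covw : forall i, cov_matrix P (w i) Sw.

Lemma cov_matrix_sym (X : T -> p.-tuple R) (S : 'M[R]_p) : cov_matrix P X S -> S^T = S.
Proof.
move=> covX; apply/matrixP => a b; rewrite mxE; apply: EFin_inj.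
by rewrite -!covX covarianceC.
Qed.

Definition sample (i : 'I_n) (om : T) := (x i om, w i om, eps i om).

Definition deviation (v : 'I_n -> R) (a b : 'cV[R]_p) (c : R) (om : T) : R :=
  n%:R^-1 * \sum_i (sample_form a b c (sample i om) ^+ 2 -
    (dotp a (Sx *m a) + dotp b (Sw *m b) + c ^+ 2 * v i)).

Lemma measurable_sample i : measurable_fun setT (sample i).
Proof.
apply: measurable_fun_pair; last exact: measurable_funP.
by apply: measurable_fun_pair; exact: measurable_funP.
Qed.

Lemma deviation_tail : exists v : 'I_n -> R, forall a b c (K t : R),
  (0 < n)%N -> 0 < K ->
  (sigx * l2norm a) ^+ 2 + (sigw * l2norm b) ^+ 2 + (sige * c) ^+ 2 <= K ^+ 2 ->
  0 < t -> t <= mgf_const * K ^+ 2 / 16 ->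
  measurable [set om | t <= `|deviation v a b c om|] /\
  (P [set om | t <= `|deviation v a b c om|]%R <=
    (2 * expR (- (n%:R * t ^+ 2 / (4 * (mgf_const * K ^+ 4)))))%:E)%E.
Proof.
have [[indep _] ind3 sgx sgw sge] := model.
have [v hv] : {v : 'I_n -> R & forall i a b c,
    has_mean P (fun om => sample_form a b c (sample i om) ^+ 2)
      (dotp a (Sx *m a) + dotp b (Sw *m b) + c ^+ 2 * v i)}.
  pose Q (i : 'I_n) (r : R) := forall a b c,
    has_mean P (fun om => sample_form a b c (sample i om) ^+ 2)
      (dotp a (Sx *m a) + dotp b (Sw *m b) + c ^+ 2 * r).
  apply: (@choice _ _ Q) => i.
  exact: (sample_form_second (measurable_funPT (x i)) (measurable_funPT (w i))
    (measurable_funPT (eps i)) (ind3 i) (sgx i) (sgw i) (sge i) (covx i) (covw i)).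
exists v => a b c K t n0 K0 HK t0 tK.
have second i : (\int[P]_om (sample_form a b c (sample i om) ^+ 2)%:E =
    (dotp a (Sx *m a) + dotp b (Sw *m b) + c ^+ 2 * v i)%:E)%E := (hv i a b c).2.
have mh := measurable_sample_form a b c.
split; last first.
  apply: (mean_sqr_concentration K0 measurable_sample indep mh _ second n0 t0 tK).
  move=> i s; apply: (sample_form_mgf _ _ _ _ (sgx i) (sgw i) (sge i)) => //.
rewrite -[X in measurable X]setTI; apply: measurable_fun_le => //.
apply: measurableT_comp => //.
by apply: measurable_mean_sqr => //; exact: measurable_sample.
Qed.

Let X om := row_matrix (fun i => x i om).
Let Z om := X om + row_matrix (fun i => w i om).

Lemma sample_form_row u om i : sample_form u u 0 (sample i om) = (Z om *m u) i 0.
Proof.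
rewrite /sample_form /sample /= mul0r addr0 mxE -big_split; apply: eq_bigr => j _.
by rewrite !mxE /=; ring.
Qed.

Lemma deviation_quad v u om : (0 < n)%N ->
  deviation v u u 0 om = dotp u (Gamma_hat (Z om) Sw *m u) - dotp u (Sx *m u).
Proof.
move=> n0; rewrite /deviation Gamma_hat_quad.
under eq_bigr do rewrite sample_form_row expr0n mul0r addr0.
rewrite sumrB sumr_const card_ord mulrBr -[X in _ - _ * X]mulr_natl.
by rewrite mulKf ?pnatr_eq0 -?lt0n//; ring.
Qed.

Lemma deviationZ v c u om :
  deviation v (c *: u) (c *: u) 0 om = c ^+ 2 * deviation v u u 0 om.
Proof.
rewrite /deviation mulrCA; congr (_ * _); rewrite mulr_sumr; apply: eq_bigr => i _.
rewrite !sample_form_row -!scalemxAr !dotpZl !dotpZr mxE; ring.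
Qed.

(** Here [Z b - y = W b - eps], so the summands [z_j (w^T b - eps)] are a quarter of the difference
    of the squares of [z_j + (w^T b - eps)] and [z_j - (w^T b - eps)]. The means of these squares
    differ by [4 (Sw b)_j], which is the correction in [Gamma_hat]. *)
Lemma residual_deviation v (b : 'cV[R]_p) j om : (0 < n)%N -> Sw^T = Sw ->
  (Gamma_hat (Z om) Sw *m b - gamma_hat (Z om) (X om *m b + \col_i eps i om)) j 0 =
  (deviation v (delta_mx j 0) (delta_mx j 0 + b) (-1) om -
   deviation v (delta_mx j 0) (delta_mx j 0 - b) 1 om) / 4.
Proof.
move=> n0 SwT; rewrite Gamma_hat_residual /deviation -mulrBr -sumrB.
set e := delta_mx j 0.
have -> : (Sw *m b) j 0 = n%:R^-1 * \sum_(i < n) (Sw *m b) j 0.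
  by rewrite sumr_const card_ord -[X in _ * X]mulr_natl mulKf// pnatr_eq0 -lt0n.
rewrite -mulrBr -mulrA -sumrB mulr_suml; congr (_ * _); apply: eq_bigr => i _.
rewrite !dotp_quadD// mulmxN !(dotpNr, dotpNl) (dotpC e (Sw *m b)) dotp_delta.
have -> : Z om i j = tnth (x i om) j + tnth (w i om) j by rewrite !mxE.
have -> : (Z om *m b - (X om *m b + \col_i0 eps i0 om)) i 0 =
    linform b (w i om) - eps i om.
  rewrite mulmxDl addrAC opprD addrA subrr sub0r addrC !mxE; congr (_ - _).
  by apply: eq_bigr => k _; rewrite !mxE mulrC.
have lfD u u' t : linform (u + u') t = linform u t + linform u' t.
  by rewrite /linform -big_split; apply: eq_bigr => k _; rewrite mxE mulrDl.
have lfN u t : linform (- u) t = - linform u t.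
  by rewrite /linform -sumrN; apply: eq_bigr => k _; rewrite mxE mulNr.
rewrite /sample_form /sample /= !lfD lfN /e !linform_delta.
by field.
Qed.

End Deviation.

(** * Restricted strong convexity *)

Section RestrictedStrongConvexity.
Context {R : realType} {p : nat}.

(** [quad_lower_of_sparse] for [G - kappa / 2]: on signed sums the deviation, at most [kappa / 2],
    costs no more than half of the curvature of [S]. *)
Lemma rsc_of_sparse (G S : 'M[R]_p) (kappa t D : R) m (v : 'cV[R]_p) :
  G^T = G -> (forall u, kappa * dotp u u <= dotp u (S *m u)) ->
  0 <= t <= kappa / 2 -> (forall j, S j j <= D) -> (1 < m)%N ->
  (forall s, size s = m ->
    `|dotp (signed_sum s) (G *m signed_sum s) -
      dotp (signed_sum s) (S *m signed_sum s)| <=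
    t * dotp (signed_sum s) (signed_sum s)) ->
  kappa / 2 * dotp v v - D / (m%:R - 1) * l1norm v ^+ 2 <= dotp v (G *m v).
Proof.
move=> GT Skappa /andP[t0 tk] SD m1 H.
pose N := G - (kappa / 2)%:M.
have NE u : dotp u (N *m u) = dotp u (G *m u) - kappa / 2 * dotp u u.
  by rewrite /N mulmxBl mul_scalar_mx dotpDr dotpNr dotpZr.
have NT : N^T = N by rewrite /N linearB /= GT tr_scalar_mx.
have ND j : N j j <= D.
  (* Repeating one basis vector [m] times makes the hypothesis on signed sums control the diagonal
     as well. *)
  have := H (nseq m (false, j)); rewrite size_nseq => /(_ erefl).
  have -> : signed_sum (nseq m (false, j)) = m%:R *: (delta_mx j 0 : 'cV[R]_p).
    rewrite /signed_sum; elim: (m) => [|k IH]; first by rewrite big_nil scale0r.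
    by rewrite /= big_cons IH /signed_basis expr0 scale1r -natr1 scalerDl scale1r addrC.
  rewrite -!scalemxAr !(dotpZl, dotpZr) -!mulrBr.
  have diag (M : 'M[R]_p) : dotp (delta_mx j 0) (M *m delta_mx j 0) = M j j.
    by rewrite dotpC dotp_delta -colE mxE.
  rewrite !diag dotp_delta mxE !eqxx mulr1.
  have m0 : 0 < m%:R * m%:R :> R by rewrite mulr_gt0// ltr0n ltnW.
  rewrite mulrA normrM (gtr0_norm m0) mulrC ler_pM2r// => h.
  have := le_trans (ler_norm _) h; have := SD j; rewrite !mxE eqxx mulr1n; lra.
have Nsparse s : size s = m -> 0 <= dotp (signed_sum s) (N *m signed_sum s).
  move=> sm; rewrite NE; have := H s sm; have := Skappa (signed_sum s).
  set u := signed_sum s; have uu := dotpvv_ge0 u.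
  rewrite ler_norml => h1 /andP[h2 _].
  have : t * dotp u u <= kappa / 2 * dotp u u by rewrite ler_wpM2r.
  lra.
by have := quad_lower_of_sparse v NT m1 ND Nsparse; rewrite NE; lra.
Qed.

End RestrictedStrongConvexity.

(** * The event on which the deterministic argument runs *)

Section GoodEvent.
Context {R : realType} d (T : measurableType d) (P : probability T R) {n p : nat}.
Variables (sigx sigw sige : R).
Variables (x w : 'I_n -> {RV P >-> p.-tuple R}) (eps : 'I_n -> {RV P >-> R}).
Variables (Sx Sw : 'M[R]_p) (bstar : 'cV[R]_p).
Hypothesis model : subgaussian_model sigx sigw sige x w eps.
Hypothesis covx : forall i, cov_matrix P (x i) Sx.
Hypothesis covw : forall i, cov_matrix P (w i) Sw.

Let X om := row_matrix (fun i => x i om).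
Let Z om := X om + row_matrix (fun i => w i om).
Let G om := Gamma_hat (Z om) Sw.
Let g om := gamma_hat (Z om) (X om *m bstar + \col_i eps i om).

Definition good (t1 t2 : R) (m : nat) (om : T) :=
  (forall s, size s = m ->
    `|dotp (signed_sum s) (G om *m signed_sum s) -
      dotp (signed_sum s) (Sx *m signed_sum s)| <=
    t1 * dotp (signed_sum s) (signed_sum s)) /\
  (forall j, `|(G om *m bstar - g om) j 0| <= t2).

(** A union over [(2p)^m] normalized signed sums and over the [2p] forms of the polarization, each
    with a two-sided tail. [K] covers them all, since [e_j + bstar] and [e_j - bstar] have l2 norm
    at most [1 + |bstar|_2]. *)
Lemma good_event (K t1 t2 : R) (m : nat) :
  (0 < n)%N -> 0 < K -> 0 <= sigx -> 0 <= sigw ->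
  sigx ^+ 2 + (sigw * (1 + l2norm bstar)) ^+ 2 + sige ^+ 2 <= K ^+ 2 ->
  0 < t1 <= mgf_const * K ^+ 2 / 16 -> 0 < t2 <= mgf_const * K ^+ 2 / 16 ->
  let rho := (4 * (mgf_const * K ^+ 4))^-1 in
  exists E : set T, [/\ measurable E,
    ((1 - ((2 * p%:R) ^+ m * (2 * expR (- (rho * n%:R * t1 ^+ 2))) +
           p%:R * (4 * expR (- (rho * n%:R * t2 ^+ 2)))))%:E <= P E)%E &
    forall om, E om -> good t1 t2 m om].
Proof.
move=> n0 K0 sigx0 sigw0 HK /andP[t10 t1K] /andP[t20 t2K] rho.
have i0 : 'I_n := Ordinal n0.
have SwT := cov_matrix_sym (covw i0).
have [v tail] := deviation_tail model covx covw.
have bigB : 1 <= 1 + l2norm bstar by rewrite lerDl l2norm_ge0.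
have sb (b : 'cV[R]_p) : l2norm b <= 1 + l2norm bstar ->
    (sigw * l2norm b) ^+ 2 <= (sigw * (1 + l2norm bstar)) ^+ 2.
  move=> hb; rewrite ler_pXn2r ?nnegrE ?mulr_ge0 ?l2norm_ge0//; first exact: ler_wpM2l.
  exact: le_trans bigB.
(* The signs may cancel to the sum 0; the inverse of 0 being 0, [dir J] is then 0 and still has norm
   at most 1. *)
pose dir (J : m.-tuple (bool * 'I_p)) : 'cV[R]_p :=
  (l2norm (signed_sum J))^-1 *: signed_sum J.
have dir1 J : l2norm (dir J) <= 1.
  have [u0|u0] := eqVneq (l2norm (signed_sum J : 'cV[R]_p)) 0.
    by rewrite /dir u0 invr0 scale0r -(scale0r (0 : 'cV[R]_p)) l2normZ normr0 mul0r.
  by rewrite /dir l2normZ ger0_norm ?invr_ge0 ?l2norm_ge0// mulVf.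
have expE t : - (n%:R * t ^+ 2 / (4 * (mgf_const * K ^+ 4))) = - (rho * n%:R * t ^+ 2).
  by rewrite /rho; congr (- _); ring.
have bad1 J : measurable [set om | t1 <= `|deviation x w eps Sx Sw v (dir J) (dir J) 0 om|] /\
    (P [set om | t1 <= `|deviation x w eps Sx Sw v (dir J) (dir J) 0 om|]%R <=
      (2 * expR (- (rho * n%:R * t1 ^+ 2)))%:E)%E.
  rewrite -expE; apply: tail => //.
  have h1 : (sigx * l2norm (dir J)) ^+ 2 <= sigx ^+ 2.
    rewrite ler_pXn2r ?nnegrE ?mulr_ge0 ?l2norm_ge0//.
    by rewrite -[leRHS]mulr1 ler_wpM2l.
  have h2 := sb (dir J) (le_trans (dir1 J) bigB).
  have := sqr_ge0 sige; rewrite mulr0 expr0n/=; lra.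
have bad2 j (sgn : bool) : let a := delta_mx j 0 in
    let b := delta_mx j 0 + (-1) ^+ sgn *: bstar in let c := - (-1) ^+ sgn in
    measurable [set om | t2 <= `|deviation x w eps Sx Sw v a b c om|] /\
    (P [set om | t2 <= `|deviation x w eps Sx Sw v a b c om|]%R <=
      (2 * expR (- (rho * n%:R * t2 ^+ 2)))%:E)%E.
  move=> a b c; rewrite -expE; apply: tail => //.
  rewrite l2norm_delta mulr1.
  have h2 : (sigw * l2norm b) ^+ 2 <= (sigw * (1 + l2norm bstar)) ^+ 2.
    apply: sb; apply: le_trans (l2normD _ _) _.
    by rewrite l2norm_delta lerD2l l2normZ normrX normrN1 expr1n mul1r.
  rewrite [(sige * c) ^+ 2]exprMn /c sqrrN sqrr_sign mulr1; lra.
have [mU1 PU1] := union_bound (fun J => (bad1 J).1) (fun J => (bad1 J).2).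
have [mU2 PU2] := @union_bound _ _ _ P ('I_p * bool)%type _ _
  (fun i => (bad2 i.1 i.2).1) (fun i => (bad2 i.1 i.2).2).
set U1 := \big[setU/set0]_(J : m.-tuple _) _ in mU1 PU1.
set U2 := \big[setU/set0]_(i : 'I_p * bool) _ in mU2 PU2.
exists (~` (U1 `|` U2)); split.
- by apply: measurableC; exact: measurableU.
- rewrite probability_setC; last exact: measurableU.
  rewrite EFinB leeB//.
  apply: le_trans (measureU2 _ mU1 mU2) _.
  rewrite EFinD; apply: leeD.
    apply: le_trans PU1 _; rewrite lee_fin card_tuple card_prod card_bool card_ord.
    by rewrite natrX natrM.
  apply: le_trans PU2 _; rewrite lee_fin card_prod card_bool card_ord natrM.
  by rewrite le_eqVlt; apply/orP; left; apply/eqP; ring.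
move=> om; rewrite setCU => -[nU1 nU2].
have U1P J : `|deviation x w eps Sx Sw v (dir J) (dir J) 0 om| < t1.
  rewrite ltNge; apply/negP => h; apply: nU1.
  by rewrite /U1 (bigD1 J)//=; left.
have U2P j (sgn : bool) : `|deviation x w eps Sx Sw v (delta_mx j 0)
    (delta_mx j 0 + (-1) ^+ sgn *: bstar) (- (-1) ^+ sgn) om| < t2.
  rewrite ltNge; apply/negP => h; apply: nU2.
  by rewrite /U2 (bigD1 (j, sgn))//=; left.
split.
- move=> s sm; have sm' : size s == m by exact/eqP.
  have := U1P (Tuple sm'); rewrite /dir /=; set u := signed_sum s.
  rewrite deviationZ deviation_quad// normrM => h.
  have [u0|u0] := eqVneq (l2norm u) 0.
    by rewrite (l2norm_eq0 u0) !dotp0l subrr normr0 mulr0.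
  have u0' : 0 < l2norm u by rewrite lt_neqAle eq_sym u0 l2norm_ge0.
  move: h; rewrite ger0_norm ?sqr_ge0// exprVn mulrC ltr_pdivrMr ?exprn_gt0//.
  by rewrite l2norm_dotp => /ltW.
- move=> j; rewrite (residual_deviation x w eps Sx v)// normrM.
  have := U2P j false; have := U2P j true.
  rewrite expr0 expr1 scale1r scaleN1r opprK.
  set a := deviation _ _ _ _ _ _ _ _ _ _; set b := deviation _ _ _ _ _ _ _ _ _ _.
  move=> ha hb; have := ler_normB b a.
  have -> : `|4^-1| = 4^-1 :> R by rewrite ger0_norm.
  lra.
Qed.

End GoodEvent.

(** * Choice of the constants and assembly *)

Theorem corollary2 (R : realType)
    (sigx sigw sige kappa B cinf eta : R)
    (sigx_gt0 : 0 < sigx) (sigw_gt0 : 0 < sigw) (sige_gt0 : 0 < sige)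
    (kappa_gt0 : 0 < kappa) (eta_lt1 : eta < 1) :
  exists c0 c1 c2 c3 cl cu : R,
    [/\ 0 < c0, 0 < c1 & 0 < c2] /\ [/\ 0 < c3, 0 < cl & 0 < cu] /\
    forall (n p k : nat) (d : measure_display) (T : measurableType d)
      (P : probability T R)
      (x w : 'I_n -> {RV P >-> p.-tuple R}) (eps : 'I_n -> {RV P >-> R})
      (Sx Sw : 'M[R]_p) (bstar : 'cV[R]_p) (lam rad : R),
    (0 < n)%N -> (0 < p)%N ->
    (#|supp bstar| <= k)%N ->
    l2norm bstar <= B ->
    (k ^ 2 <= n)%N ->
    c0 * k%:R * ln (p%:R : R) <= n%:R ->
    subgaussian_model sigx sigw sige x w eps ->
    (forall i, cov_matrix P (x i) Sx) ->
    (forall i, cov_matrix P (w i) Sw) ->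
    kappa <= lambda_min Sx ->
    0 < rad ->
    l1norm bstar <= rad / 2 ->
    cl * Num.sqrt (ln p%:R / n%:R) <= lam ->
    lam <= cu / rad ->
    let S := supp bstar in
    let X := fun om : T => row_matrix (fun i => x i om) in
    let Z := fun om : T => X om + row_matrix (fun i => w i om) in
    let y := fun om : T => X om *m bstar + \col_i eps i om in
    let G := fun om : T => Gamma_hat (Z om) Sw in
    let g := fun om : T => gamma_hat (Z om) (y om) in
    exists E : set T,
      [/\ measurable E,
          ((1 - c1 * expR (- (c2 * Num.min k%:R (ln p%:R))))%:E <= P E)%E &
          forall om, E om ->
            let GSS := submx_of (G om) S S in
            let GScS := submx_of (G om) (~: S)%SET S in
            GSS \in unitmx ->
            linf_opnorm (invmx GSS) <= cinf ->
            linf_opnorm (GScS *m invmx GSS) <= eta ->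
            exists bhat : 'cV[R]_p,
              [/\ stationary_point (G om) (g om) lam rad bhat,
                  forall b, stationary_point (G om) (g om) lam rad b ->
                    b = bhat,
                  global_optimum (G om) (g om) lam rad bhat,
                  supp bhat \subset S &
                  linfnorm (bhat - bstar) <=
                    c3 * Num.sqrt (ln p%:R / n%:R) + cinf * lam]].
Proof.
(* K bounds the sub-Gaussian parameters of all linear forms used; t1 and t2 are
   the deviation levels for restricted strong convexity and for the noise. *)
pose K := sigx + sigw * (1 + `|B|) + sige.
have B1 : 0 < 1 + `|B| by rewrite ltr_wpDr.
have K0 : 0 < K by rewrite !addr_gt0// mulr_gt0.
have C0 : 0 < mgf_const :> R := mgf_const_gt0.
pose rho := (4 * (mgf_const * K ^+ 4))^-1.
have rho0 : 0 < rho by rewrite invr_gt0 !mulr_gt0// exprn_gt0.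
(* The largest deviation level that [mean_sqr_concentration] admits. *)
pose cap := mgf_const * K ^+ 2 / 16.
have cap0 : 0 < cap by rewrite divr_gt0// mulr_gt0// exprn_gt0.
pose t1 := Num.min (kappa / 2) cap.
have t10 : 0 < t1 by rewrite lt_min cap0 divr_gt0.
pose rho1 := rho * t1 ^+ 2.
have rho10 : 0 < rho1 by rewrite mulr_gt0// exprn_gt0.
(* Makes [rho n t2^2 = 2 log p]: one [log p] pays for the union over coordinates, the other remains
   as decay. *)
pose c' := Num.sqrt (2 / rho).
have c'0 : 0 < c' by rewrite sqrtr_gt0 divr_gt0.
have c'2 : c' ^+ 2 = 2 / rho by rewrite sqr_sqrtr// divr_ge0// ltW.
pose D := 8 * expR (sigx ^+ 2 / 2).
have D0 : 0 < D by rewrite mulr_gt0// expR_gt0.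
(* [tau0 (log p) / n] is [2 D / a] for the [a] below, whose integer part is the number [m] of
   draws. *)
pose tau0 := 8 * D / rho1.
have tau00 : 0 < tau0 by rewrite divr_gt0// mulr_gt0.
have eta10 : 0 < 1 - eta by rewrite subr_gt0.
(* The two summands yield [phi_lam] and [phi_eta] for the noise level [t2]. *)
pose cl := 4 * c' + 2 * c' * (1 + `|eta|) / (1 - eta).
have cl1 : 0 <= 2 * c' * (1 + `|eta|) / (1 - eta).
  by apply: divr_ge0 (ltW eta10); apply: mulr_ge0; [rewrite mulr_ge0// ltW | rewrite addr_ge0].
have cl0 : 0 < cl by rewrite ltr_wpDr// mulr_gt0.
(* Solves [16 tau rad <= lam (1 - eta)] after inserting [(log p) / n <= lam^2 / cl^2] and
   [lam rad <= cu]. *)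
pose cu := (1 - eta) * cl ^+ 2 / (16 * tau0).
have cu0 : 0 < cu by apply: divr_gt0; rewrite mulr_gt0 ?exprn_gt0.
(* The summands ensure, in this order, [a >= 4], [t2 <= cap] and [tauS]. *)
pose c0 := 16 / rho1 + 2 / (rho * cap ^+ 2) + 8 * tau0 / kappa.
have c01 : 0 < 16 / rho1 by rewrite divr_gt0.
have c02 : 0 < 2 / (rho * cap ^+ 2) by rewrite divr_gt0// mulr_gt0// exprn_gt0.
have c03 : 0 < 8 * tau0 / kappa by rewrite divr_gt0// mulr_gt0.
(* 6 = 2 + 4 collects the tails of the two unions; the [+ 1] keeps [c3] positive when [cinf = 0]. *)
exists c0, 6, 1, (`|cinf| * c' + 1), cl, cu.
split; first by split => //; rewrite !addr_gt0.
split; first by split => //; rewrite ltr_wpDl// mulr_ge0// ltW.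
move=> n p k d T P x w eps Sx Sw bstar lam rad n0 p0 Sk bB _ hn model covx covw.
move=> kSx rad0 brad hlam hcu S X Z y G g.
set L := ln (p%:R : R) in hn hlam *.
have p0R : 0 < p%:R :> R by rewrite ltr0n.
have [triv|] := boolP ((k == 0)%N || (p <= 1)%N).
  (* min(k, log p) <= 0, so that the probability bound is vacuous. *)
  exists set0; split => //.
  rewrite measure0 lee_fin mul1r.
  have m0 : Num.min k%:R L <= 0.
    case/orP: triv => [/eqP ->|p1]; first by rewrite ge_min lexx.
    by rewrite ge_min ln_le0 ?orbT// -[1]/(1%:R) ler_nat.
  by move: m0 (expR_ge1Dx (- Num.min k%:R L : R)); clear; lra.
rewrite negb_or -lt0n -ltnNge => /andP[k0 p1].
have k1R : 1 <= k%:R :> R by rewrite ler1n.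
have p2R : 2 <= p%:R :> R by rewrite ler_nat.
have n0R : 0 < n%:R :> R by rewrite ltr0n.
have L0 : 0 < L by rewrite ln_gt0// ltr1n.
have expL : expR L = p%:R by rewrite lnK.
have kL : L <= k%:R * L by rewrite ler_peMl// ltW.
have c0kL : c0 * L <= c0 * (k%:R * L) by rewrite ler_wpM2l// ltW// !addr_gt0.
have kL0 : 0 <= k%:R * L by rewrite mulr_ge0// ltW.
have hn' : c0 * (k%:R * L) <= n%:R by rewrite mulrA.
have N1 : 16 / rho1 * L <= n%:R.
  apply: le_trans (le_trans c0kL hn'); rewrite ler_pM2r// /c0.
  by move: c01 c02 c03; clear; lra.
have N2 : 2 / (rho * cap ^+ 2) * L <= n%:R.
  apply: le_trans (le_trans c0kL hn'); rewrite ler_pM2r// /c0.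
  by move: c01 c02 c03; clear; lra.
have N3 : 8 * tau0 / kappa * (k%:R * L) <= n%:R.
  apply: le_trans hn'; rewrite ler_wpM2r// /c0.
  by move: c01 c02 c03; clear; lra.
pose t2 := c' * Num.sqrt (L / n%:R).
have Ln0 : 0 < L / n%:R by rewrite divr_gt0.
have sq0 : 0 < Num.sqrt (L / n%:R) by rewrite sqrtr_gt0.
have sq2 : Num.sqrt (L / n%:R) ^+ 2 = L / n%:R by rewrite sqr_sqrtr// ltW.
have t20 : 0 < t2 by rewrite mulr_gt0.
have t2sq : t2 ^+ 2 = 2 / rho * (L / n%:R) by rewrite exprMn c'2 sq2.
have t2cap : t2 <= cap.
  rewrite -(ler_pXn2r (n := 2)) ?nnegrE ?(ltW t20) ?(ltW cap0)//.
  rewrite t2sq mulrA ler_pdivrMr// [leRHS]mulrC.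
  move: N2; rewrite -(ler_pM2r (exprn_gt0 2 cap0)); apply: le_trans.
  rewrite le_eqVlt; apply/orP; left; apply/eqP; field.
  by rewrite !gt_eqF.
have e2 : rho * n%:R * t2 ^+ 2 = 2 * L.
  by rewrite t2sq; field; rewrite !gt_eqF.
have e1 : rho * n%:R * t1 ^+ 2 = rho1 * n%:R by rewrite /rho1 mulrAC.
(* For [m <= a], [(2p)^m <= p^(2m) <= exp (rho1 n / 2)]: the union over signed sums uses up only
   half of the exponent [rho1 n]. *)
pose a := rho1 * n%:R / (4 * L).
have L40 : 0 < 4 * L by rewrite mulr_gt0.
have aL : a * (4 * L) = rho1 * n%:R by rewrite divfK// gt_eqF.
have rn16 : 16 * L <= rho1 * n%:R.
  move: N1; rewrite -(ler_pM2l rho10); apply: le_trans.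
  rewrite le_eqVlt; apply/orP; left; apply/eqP; field.
  by rewrite gt_eqF.
have a4 : 4 <= a by rewrite ler_pdivlMr//; move: rn16; clear; lra.
pose m := Num.truncn a.
have /andP[ma am] : m%:R <= a < m.+1%:R by apply: truncn_itv; exact: le_trans a4.
have m1 : (1 < m)%N.
  by rewrite -(ltr_nat R); move: a4 am; rewrite -natr1; clear; lra.
have b0 : 0 <= l2norm bstar := l2norm_ge0 _.
have HK : sigx ^+ 2 + (sigw * (1 + l2norm bstar)) ^+ 2 + sige ^+ 2 <= K ^+ 2.
  have h1 : sigw * (1 + l2norm bstar) <= sigw * (1 + `|B|).
    by rewrite ler_pM2l// lerD2l (le_trans bB)// ler_norm.
  have h2 : 0 <= sigw * (1 + l2norm bstar) by rewrite mulr_ge0 ?addr_ge0// ltW.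
  have h3 : (sigw * (1 + l2norm bstar)) ^+ 2 <= (sigw * (1 + `|B|)) ^+ 2.
    by rewrite ler_pXn2r// nnegrE (le_trans h2).
  apply: le_trans (_ : sigx ^+ 2 + (sigw * (1 + `|B|)) ^+ 2 + sige ^+ 2 <= _).
    by rewrite lerD2r lerD2l.
  have h4 : 0 <= sigw * (1 + `|B|) := le_trans h2 h1.
  rewrite /K; set z := sigw * (1 + `|B|) in h4 *.
  have := mulr_ge0 (ltW sigx_gt0) h4; have := mulr_ge0 (ltW sige_gt0) h4.
  have := mulr_gt0 sigx_gt0 sige_gt0; clear; lra.
have t1cap : 0 < t1 <= cap by rewrite t10 ge_min lexx orbT.
have t2cap' : 0 < t2 <= cap by rewrite t20.
have [E [mE PE goodE]] := good_event model covx covw m n0 K0 (ltW sigx_gt0)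
  (ltW sigw_gt0) HK t1cap t2cap'.
exists E; split => //.
  apply: le_trans PE; rewrite lee_fin lerD2l lerN2 -/rho e1 e2 mul1r.
  have h1 : (2 * p%:R) ^+ m <= expR (rho1 * n%:R / 2).
    apply: (@le_trans _ _ (expR (2 * L) ^+ m)).
      rewrite lerXn2r ?nnegrE ?mulr_ge0 ?expR_ge0//.
      have -> : expR (2 * L) = p%:R * p%:R.
        by rewrite -expL -expRD; congr expR; ring.
      by rewrite ler_wpM2r.
    rewrite -expRM_natl ler_expR; have : m%:R * L <= a * L by rewrite ler_pM2r.
    by move: aL; clear; lra.
  have h2 : (2 * p%:R) ^+ m * (2 * expR (- (rho1 * n%:R))) <= 2 * expR (- L).
    apply: (@le_trans _ _ (expR (rho1 * n%:R / 2) * (2 * expR (- (rho1 * n%:R))))).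
      by rewrite ler_wpM2r// mulr_ge0 ?expR_ge0.
    rewrite mulrCA ler_pM2l// -expRD ler_expR.
    by move: rn16 L0; clear; lra.
  have h3 : p%:R * (4 * expR (- (2 * L))) = 4 * expR (- L).
    by rewrite -expL mulrCA -expRD; congr (_ * expR _); ring.
  have h4 : expR (- L) <= expR (- Num.min k%:R L).
    by rewrite ler_expR lerN2 ge_min lexx orbT.
  by rewrite h3; apply: le_trans (lerD h2 (lexx _)) _; move: h4; clear; lra.
move=> om /goodE[sparse noise] GSS GScS GSSu Hcinf Heta.
have i0 : 'I_n := Ordinal n0.
have SxT := cov_matrix_sym (covx i0); have SwT := cov_matrix_sym (covw i0).
have GT : (G om)^T = G om by exact: Gamma_hat_sym.
have Skappa u : kappa * dotp u u <= dotp u (Sx *m u).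
  by apply: le_trans (lambda_min_quad u SxT); rewrite ler_wpM2r ?dotpvv_ge0.
have [_ _ sgx _ _] := model.
have SD j : Sx j j <= D.
  exact: (cov_matrix_diag_le j (measurable_funPT (x i0)) (sgx i0) (covx i0)).
pose tau := tau0 * (L / n%:R).
have tau_ge0 : 0 <= tau by rewrite mulr_ge0// ltW.
have m10 : 0 < m%:R - 1 :> R by rewrite subr_gt0 ltr1n.
have Dm : D / (m%:R - 1) <= tau.
  rewrite ler_pdivrMr//.
  have -> : tau = 2 * D / a.
    rewrite /tau /tau0 /a; field.
    by rewrite !gt_eqF.
  rewrite mulrAC ler_pdivlMr; last exact: lt_le_trans a4.
  (* [m - 1 > a - 2 >= a / 2], since [a >= 4]. *)
  have h : a <= 2 * (m%:R - 1) by move: a4 am; rewrite -natr1; clear; lra.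
  by move: (ler_wpM2l (ltW D0) h); clear; lra.
have rsc v : kappa / 2 * dotp v v - tau * l1norm v ^+ 2 <= dotp v (G om *m v).
  have t1k : 0 <= t1 <= kappa / 2 by rewrite ltW// ge_min lexx.
  apply: le_trans (rsc_of_sparse v GT Skappa t1k SD m1 sparse).
  by rewrite lerD2l lerN2 ler_wpM2r// sqr_ge0.
have lam0 : 0 < lam by apply: lt_le_trans hlam; rewrite mulr_gt0.
have kappa20 : 0 < kappa / 2 by rewrite divr_gt0.
have tauS : 4 * tau * #|supp bstar|%:R <= kappa / 2.
  apply: (@le_trans _ _ (4 * tau * k%:R)).
    by apply: ler_wpM2l; [exact: mulr_ge0 | rewrite ler_nat].
  move: N3; rewrite -(ler_pM2l (_ : 0 < kappa / (2 * n%:R))) ?divr_gt0 ?mulr_gt0//.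
  have -> : kappa / (2 * n%:R) * (8 * tau0 / kappa * (k%:R * L)) = 4 * tau * k%:R.
    by rewrite /tau; field; rewrite !gt_eqF.
  have -> // : kappa / (2 * n%:R) * n%:R = kappa / 2.
  by field; rewrite gt_eqF.
have cls : cl * Num.sqrt (L / n%:R) = 4 * t2 + 2 * t2 * (1 + `|eta|) / (1 - eta).
  by rewrite /cl /t2; field; rewrite gt_eqF.
have ets : 0 <= 2 * t2 * (1 + `|eta|) / (1 - eta).
  by apply: divr_ge0 (ltW eta10); apply: mulr_ge0; [rewrite mulr_ge0// ltW | rewrite addr_ge0].
have phi_lam : 4 * t2 <= lam by move: hlam cls ets t20; clear; lra.
have phi_eta : (1 + eta) * t2 <= lam * ((1 - eta) / 2).
  have h : 2 * t2 * (1 + `|eta|) / (1 - eta) <= lam by move: hlam cls ets t20; clear; lra.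
  rewrite ler_pdivrMr// in h.
  have : t2 * eta <= t2 * `|eta| by rewrite ler_wpM2l ?ler_norm// ltW.
  by move: h; clear; lra.
have tau_lam : 16 * tau * rad <= lam * (1 - eta).
  have h1 : cl ^+ 2 * (L / n%:R) <= lam ^+ 2.
    rewrite -sq2 -exprMn ler_pXn2r// nnegrE ltW// mulr_gt0//.
  have h2 : lam * rad <= cu by rewrite -ler_pdivlMr.
  have h3 : lam * (lam * rad) <= lam * cu by rewrite ler_pM2l.
  have h4 : cl ^+ 2 * (L / n%:R) * rad <= lam * cu.
    by apply: le_trans h3; rewrite mulrA -expr2 ler_pM2r.
  have cl20 : 0 < cl ^+ 2 by rewrite exprn_gt0.
  have h5 := ler_wpM2l (ltW (divr_gt0 (mulr_gt0 (ltr0Sn R 15) tau00) cl20)) h4.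
  have e3 : 16 * tau0 / cl ^+ 2 * (cl ^+ 2 * (L / n%:R) * rad) = 16 * tau * rad.
    by rewrite /tau; field; rewrite !gt_eqF.
  have e4 : 16 * tau0 / cl ^+ 2 * (lam * cu) = lam * (1 - eta).
    by rewrite /cu; field; rewrite !gt_eqF.
  by rewrite -e3 -e4.
have [bhat [st uq go sS linf]] := primal_dual_witness GT kappa20 tau_ge0 rsc
  (ltW t20) noise lam0 rad0 brad tauS phi_lam phi_eta tau_lam eta_lt1 GSSu Hcinf Heta.
exists bhat; split => //; apply: le_trans linf _.
rewrite mulrDr lerD2r mulrDl mul1r -mulrA -/t2.
have : cinf * t2 <= `|cinf| * t2 by rewrite ler_wpM2r ?ler_norm// ltW.
by move: sq0; clear; lra.
Qed.
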